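(* Let $\lambda$ be a partition of $n$, $(\alpha|\beta)$ a bicomposition of $n$ and $\mathbb{F}$ a field. Suppose that $\mathbb{F}\mathfrak{S}_n$ is semisimple as an algebra (equivalently, $\mathrm{char}(\mathbb{F})=0$ or $\mathrm{char}(\mathbb{F})>n$). Then $\Theta^{\mathbb{F}}_{\mathrm{sstd}}=\{\hat\vartheta^{\mathbb{F}}_{\mathfrak{d}}:\mathfrak{d}\in\Gamma_{\mathrm{sstd}}\}$ is a basis for $\mathrm{Hom}_{\mathbb{F}\mathfrak{S}_n}\big(S^\lambda_{\mathbb{F}},M_{\mathbb{F}}(\alpha|\beta)\big)$.
   Context: $\mathfrak{S}_n$ is the symmetric group on $\{1,\dots,n\}$ with product given by composition of functions; $n\ge1$. A composition is a finite sequence of positive integers (the empty one, $\varnothing$, is the composition of $0$); $|\lambda|$ is the sum of the parts, $\ell(\lambda)$ the number of parts; a partition is a weakly decreasing composition. A bicomposition $(\alpha|\beta)$ of $n$ is a pair of compositions with $|\alpha|+|\beta|=n$. For a composition $\mu$ of $m$, $\mathfrak{S}_\mu\le\mathfrak{S}_m$ is the Young subgroup of permutations preserving each of the consecutive blocks of sizes $\mu_1,\mu_2,\dots$ of $\{1,\dots,m\}$. For $\xi\in\mathfrak{S}_m$ and $k\ge0$, $\xi^{+k}$ is the permutation of $\{k+1,\dots,k+m\}$ with $\xi^{+k}(x+k)=\xi(x)+k$ (extended by the identity). $\mathfrak{S}_{\alpha|\beta}=\mathfrak{S}_\alpha\mathfrak{S}_\beta^{+|\alpha|}\cong\mathfrak{S}_\alpha\times\mathfrak{S}_\beta$.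 Tableaux: $[\lambda]=\{(i,j):1\le i\le\ell(\lambda),1\le j\le\lambda_i\}$. A $\lambda$-tableau is a bijection $\mathfrak{t}\colon[\lambda]\to\{1,\dots,n\}$. $R_{\mathfrak{t}}$ (resp. $C_{\mathfrak{t}}$) $\le\mathfrak{S}_n$ is the subgroup of permutations preserving the set of entries of each row (resp. column) of $\mathfrak{t}$. A $\lambda$-tableau of type $(\alpha|\beta)$ is a function $\mathrm{T}\colon[\lambda]\to\{\mathbf{c}_1,\dots,\mathbf{c}_{\ell(\alpha)},\mathbf{d}_1,\dots,\mathbf{d}_{\ell(\beta)}\}$ taking the value $\mathbf{c}_i$ exactly $\alpha_i$ times and $\mathbf{d}_j$ exactly $\beta_j$ times. Colours are ordered $\mathbf{c}_1<\mathbf{c}_2<\cdots<\mathbf{d}_1<\mathbf{d}_2<\cdots$. $\mathrm{T}$ is semistandard if rows and columns are weakly increasing, equal entries in distinct nodes of the same row occur only for colours $\mathbf{c}_k$, and equal entries in distinct nodes of the same column occur only for colours $\mathbf{d}_k$; $\mathcal{T}_{\mathrm{sstd}}(\lambda,(\alpha|\beta))$ is the set of these. Fix a $\lambda$-tableau $\mathfrak{t}_0$. $\mathrm{T}_0$ is the tableau of type $(\alpha|\beta)$ colouring the nodes labelled $1,\dots,\alpha_1$ by $\mathfrak{t}_0$ with $\mathbf{c}_1$, the next $\alpha_2$ labels with $\mathbf{c}_2$, and so on through $\mathbf{c}_{\ell(\alpha)}$, then $\mathbf{d}_1$ for the next $\beta_1$ labels, etc. $\mathfrak{S}_n$ acts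 by $\sigma\cdot\mathrm{T}=\mathrm{T}\circ\mathfrak{t}_0^{-1}\circ\sigma^{-1}\circ\mathfrak{t}_0$, and $\mathrm{T}_d=d\cdot\mathrm{T}_0$. Fix a left transversal $\Gamma$ of $\mathfrak{S}_{\alpha|\beta}$ in $\mathfrak{S}_n$ (representatives of left cosets) and put $\Gamma_{\mathrm{sstd}}=\{d\in\Gamma:\mathrm{T}_d\in\mathcal{T}_{\mathrm{sstd}}(\lambda,(\alpha|\beta))\}$. Coefficients: $\mathcal{R}=\{d\in\mathfrak{S}_n:d^{-1}R_{\mathfrak{t}_0}d\cap\mathfrak{S}_{\alpha|\beta}\subseteq\mathfrak{S}_\alpha\}$; one has $\Gamma_{\mathrm{sstd}}\subseteq\mathcal{R}$. For $\mathfrak{d}\in\mathcal{R}$ there is a well-defined map $\varepsilon_{\mathfrak{d}}\colon R_{\mathfrak{t}_0}\mathfrak{d}\mathfrak{S}_{\alpha|\beta}\to\{\pm1\}$, $\varepsilon_{\mathfrak{d}}(\tau\mathfrak{d}\xi_\alpha\xi_\beta^{+|\alpha|})=\mathrm{sgn}(\xi_\beta)$ ($\tau\in R_{\mathfrak{t}_0}$, $(\xi_\alpha,\xi_\beta)\in\mathfrak{S}_\alpha\times\mathfrak{S}_\beta$). For $d\in\mathfrak{S}_n$, $\mathfrak{a}_{d,\mathfrak{d}}=\sum\mathrm{sgn}(\sigma)\varepsilon_{\mathfrak{d}}(\sigma d)\in\mathbb{Z}$, the sum over $\sigma\in C_{\mathfrak{t}_0}$ with $\sigma d\in R_{\mathfrak{t}_0}\mathfrak{d}\mathfrak{S}_{\alpha|\beta}$.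 Modules, for $\mathcal{O}=\mathbb{Z}$ or a field: $M^\lambda_{\mathcal{O}}$ is the permutation $\mathcal{O}\mathfrak{S}_n$-module on $\mathfrak{S}_n/\mathfrak{S}_\lambda$; with $\mathfrak{t}^\lambda(i,j)=\lambda_1+\dots+\lambda_{i-1}+j$ and $d_{\mathfrak{t}}=\mathfrak{t}\circ(\mathfrak{t}^\lambda)^{-1}$, $e_{\mathfrak{t}}=\sum_{\sigma\in C_{\mathfrak{t}}}\mathrm{sgn}(\sigma)\sigma d_{\mathfrak{t}}\mathfrak{S}_\lambda$; $S^\lambda_{\mathcal{O}}$ is the $\mathcal{O}$-span of all $e_{\mathfrak{t}}$. $M_{\mathcal{O}}(\alpha|\beta)=\mathrm{Ind}_{\mathfrak{S}_\alpha\times\mathfrak{S}_\beta}^{\mathfrak{S}_n}(\mathcal{O}\boxtimes\mathrm{sgn})$ (identifying $\mathfrak{S}_\alpha\times\mathfrak{S}_\beta$ with $\mathfrak{S}_{\alpha|\beta}$) has basis $\{d\otimes1\otimes\epsilon:d\in\Gamma\}$, with $\sigma\cdot(x\otimes1\otimes\epsilon)=\sigma x\otimes1\otimes\epsilon$ and $x\xi_\alpha\xi_\beta^{+|\alpha|}\otimes1\otimes\epsilon=\mathrm{sgn}(\xi_\beta)(x\otimes1\otimes\epsilon)$. Homomorphisms: for $\mathfrak{d}\in\mathcal{R}$ there is a $\mathbb{Z}\mathfrak{S}_n$-homomorphism $\hat\vartheta_{\mathfrak{d}}\colon S^\lambda_{\mathbb{Z}}\to M_{\mathbb{Z}}(\alpha|\beta)$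 with $\hat\vartheta_{\mathfrak{d}}(e_{\mathfrak{t}})=\sum_{d\in\Gamma}\mathfrak{a}_{\rho_{\mathfrak{t}}^{-1}d,\mathfrak{d}}(d\otimes1\otimes\epsilon)$, where $\rho_{\mathfrak{t}}=\mathfrak{t}\circ\mathfrak{t}_0^{-1}$. For a field $\mathbb{F}$, $\hat\vartheta^{\mathbb{F}}_{\mathfrak{d}}\colon S^\lambda_{\mathbb{F}}\to M_{\mathbb{F}}(\alpha|\beta)$ is the induced $\mathbb{F}\mathfrak{S}_n$-homomorphism $\hat\vartheta^{\mathbb{F}}_{\mathfrak{d}}(e_{\mathfrak{t}})=\sum_{d\in\Gamma}\mathfrak{a}^{\mathbb{F}}_{\rho_{\mathfrak{t}}^{-1}d,\mathfrak{d}}(d\otimes1\otimes\epsilon)$, where $k^{\mathbb{F}}=k\cdot1_{\mathbb{F}}$ for $k\in\mathbb{Z}$. *)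

(* Defs.v *)
From HB Require Import structures.
From mathcomp Require Import all_boot all_order all_algebra all_fingroup.
From mathcomp Require Import all_solvable all_field all_character.

Set Implicit Arguments.
Unset Strict Implicit.
Unset Printing Implicit Defensive.

Import GroupScope GRing.Theory.
Local Open Scope ring_scope.

(* Labels are numbered from 0: the set {1, ..., n} is the ordinal type 'I_n.
   The product of permutations is composition of functions, (s ** t) x = s (t x),
   whereas (s * t)%g x is t (s x).  In particular the module regular_repr, where g
   acts by right multiplication for (_ * _)%g, is the left regular module for **. *)
Notation "s ** t" := (t * s)%g (at level 40, left associativity).

Record bicomposition (n : nat) := Bicomposition {
  cpart : seq nat;
  dpart : seq nat;
  bicompositionP : [&& all (leq 1) cpart, all (leq 1) dpart
                     & (sumn cpart + sumn dpart == n)%N]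
}.

Record intpartition (n : nat) := IntPartition {
  parts :> seq nat;
  intpartitionP : [&& sorted geq parts, all (leq 1) parts & sumn parts == n]
}.

Lemma sumn_parts n (l : intpartition n) : sumn l = n.
Proof. by case: l => l /= /and3P[_ _ /eqP]. Qed.

(* young_shift n k mu is the subgroup S_mu^{+k} of S_n: the permutations that
   preserve each of the consecutive blocks of sizes mu_1, mu_2, ... of the
   interval {k, ..., k + |mu| - 1} and fix all the other points.  Here
   reshape_index mu y is the index of the block of mu containing y. *)
Definition young_shift (n k : nat) (mu : seq nat) : {set 'S_n} :=
  [set s : 'S_n | [forall x : 'I_n,
     if (k <= x < k + sumn mu)%N then
       (k <= s x < k + sumn mu)%N &&
       (reshape_index mu (s x - k) == reshape_index mu (x - k))
     else s x == x]].

Definition young_c n (ab : bicomposition n) := young_shift n 0 (cpart ab).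
Definition young_d n (ab : bicomposition n) :=
  young_shift n (sumn (cpart ab)) (dpart ab).
Definition young_cd n (ab : bicomposition n) : {set 'S_n} :=
  [set a ** b | a in young_c ab, b in young_d ab].

Definition left_transversal n (H G : {set 'S_n}) : Prop :=
  forall x : 'S_n, exists! g : 'S_n, g \in G /\ exists2 h, h \in H & x = g ** h.

Section YoungSubgroups.
Variable n : nat.

Lemma young_shiftP k mu (s : 'S_n) :
  reflect (forall x : 'I_n, if (k <= x < k + sumn mu)%N then
       (k <= s x < k + sumn mu)%N &&
       (reshape_index mu (s x - k) == reshape_index mu (x - k))
     else s x == x) (s \in young_shift n k mu).
Proof. by rewrite inE; apply: forallP. Qed.

Lemma young_shift_group k mu : group_set (young_shift n k mu).
Proof.
apply/group_setP; split=> [|s t /young_shiftP Ss /young_shiftP St].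
  by apply/young_shiftP => x; rewrite perm1; case: ifP => [->|]; rewrite !eqxx.
apply/young_shiftP => x; rewrite permM; have Hx := Ss x; have Hsx := St (s x).
case: ifPn Hx => [_ /andP[Isx /eqP <-]|/negPf Ix /eqP Esx].
  by rewrite Isx in Hsx.
by rewrite Esx Ix in Hsx *.
Qed.
Canonical young_shift_Group k mu := Group (young_shift_group k mu).

Variable ab : bicomposition n.

Lemma young_cd_fix a b (x : 'I_n) : a \in young_c ab -> b \in young_d ab ->
  (if (x < sumn (cpart ab))%N then b x = x /\ (a x < sumn (cpart ab))%N
   else a x = x /\ (sumn (cpart ab) <= b x)%N).
Proof.
move=> /young_shiftP/(_ x) + /young_shiftP/(_ x).
rewrite /= add0n; case: ltnP => /= [_ /andP[-> _] /eqP -> //|le_x /eqP ->].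
by case: ifP => [_ /andP[/andP[->]]|_ /eqP ->].
Qed.

Lemma young_cdC a b : a \in young_c ab -> b \in young_d ab -> (a * b = b * a)%g.
Proof.
move=> Sa Sb; apply/permP => x; rewrite !permM.
have := young_cd_fix x Sa Sb; case: ltnP => [_ [bx lt]|_ [ax le]].
  by have := young_cd_fix (a x) Sa Sb; rewrite lt bx => -[-> _].
by have := young_cd_fix (b x) Sa Sb; rewrite ltnNge le ax => -[-> _].
Qed.

Lemma young_cd1 x : x \in young_c ab -> x \in young_d ab -> x = 1%g.
Proof.
move=> Sc Sd; apply/permP => y; rewrite perm1.
by have := young_cd_fix y Sc Sd; case: ifP => _ [].
Qed.

End YoungSubgroups.

Definition node (l : seq nat) := {i : 'I_(size l) & 'I_(nth 0%N l i)}.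
HB.instance Definition _ l := Finite.on (node l).

Definition nrow l (u : node l) : nat := tag u.
Definition ncol l (u : node l) : nat := tagged u.

Record tableau (l : seq nat) (n : nat) := Tableau {
  tab :> {ffun node l -> 'I_n};
  tab_bij : injectiveb tab && [forall x, x \in codom tab]
}.
HB.instance Definition _ l n := [isSub for @tab l n].
HB.instance Definition _ l n := [Finite of tableau l n by <:].

Section TableauInverse.
Variables (l : seq nat) (n : nat).
Implicit Types t s : tableau l n.

Lemma tab_inj t : injective t.
Proof. by case/andP: (tab_bij t) => /injectiveP. Qed.

Lemma tab_codom t x : x \in codom t.
Proof. by case/andP: (tab_bij t) => _ /forallP. Qed.

Definition tab_inv t (x : 'I_n) : node l := iinv (tab_codom t x).

Lemma tab_invK t : cancel (tab_inv t) t.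
Proof. by move=> x; apply: f_iinv. Qed.

Lemma tabK t : cancel t (tab_inv t).
Proof. by move=> u; apply: (@tab_inj t); rewrite tab_invK. Qed.

Lemma tab_perm_inj t s : injective (fun x => t (tab_inv s x)).
Proof. exact: inj_comp (@tab_inj t) (can_inj (tab_invK s)). Qed.

(* the permutation t o s^{-1} *)
Definition tab_perm t s : 'S_n := perm (@tab_perm_inj t s).

Definition row_entries t (i : nat) : {set 'I_n} :=
  [set t u | u : node l & nrow u == i].
Definition col_entries t (j : nat) : {set 'I_n} :=
  [set t u | u : node l & ncol u == j].

Definition row_stab t : {set 'S_n} :=
  [set s : 'S_n | [forall u : node l,
     s @: row_entries t (nrow u) == row_entries t (nrow u)]].
Definition col_stab t : {set 'S_n} :=
  [set s : 'S_n | [forall u : node l,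
     s @: col_entries t (ncol u) == col_entries t (ncol u)]].

Lemma tab_perm_tab t s u : tab_perm t s (s u) = t u.
Proof. by rewrite permE tabK. Qed.

Section Stabilizers.
Variables (f : node l -> nat).

Definition entries t (i : nat) : {set 'I_n} := [set t u | u : node l & f u == i].

Lemma mem_entries t i x : (x \in entries t i) = (f (tab_inv t x) == i).
Proof.
apply/imsetP/idP => [[u]|fx]; first by rewrite inE => fu ->; rewrite tabK.
by exists (tab_inv t x); rewrite ?inE ?tab_invK.
Qed.

Lemma entries_stabP t (s : 'S_n) :
  reflect (forall x, f (tab_inv t (s x)) = f (tab_inv t x))
    [forall u : node l, s @: entries t (f u) == entries t (f u)].
Proof.
apply: (iffP forallP) => [H x|H u].
  have := imset_f s (_ : x \in entries t (f (tab_inv t x))).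
  by rewrite mem_entries eqxx (eqP (H _)) mem_entries => /(_ isT)/eqP.
rewrite eqEcard card_imset ?leqnn ?andbT; last exact: perm_inj.
by apply/subsetP => _ /imsetP[x + ->]; rewrite !mem_entries H.
Qed.

End Stabilizers.

Lemma row_stabP t (s : 'S_n) :
  reflect (forall x, nrow (tab_inv t (s x)) = nrow (tab_inv t x)) (s \in row_stab t).
Proof. by rewrite inE; apply: entries_stabP. Qed.

Lemma col_stabP t (s : 'S_n) :
  reflect (forall x, ncol (tab_inv t (s x)) = ncol (tab_inv t x)) (s \in col_stab t).
Proof. by rewrite inE; apply: entries_stabP. Qed.

Lemma row_stab_group t : group_set (row_stab t).
Proof.
apply/group_setP; split=> [|r s /row_stabP Hr /row_stabP Hs].
  by apply/row_stabP => x; rewrite perm1.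
by apply/row_stabP => x; rewrite permM Hs Hr.
Qed.
Canonical row_stab_Group t := Group (row_stab_group t).

Lemma col_stab_group t : group_set (col_stab t).
Proof.
apply/group_setP; split=> [|r s /col_stabP Hr /col_stabP Hs].
  by apply/col_stabP => x; rewrite perm1.
by apply/col_stabP => x; rewrite permM Hs Hr.
Qed.
Canonical col_stab_Group t := Group (col_stab_group t).

Lemma tab_inv_perm t s x : tab_inv t (tab_perm t s x) = tab_inv s x.
Proof. by rewrite permE tabK. Qed.

Lemma tab_perm_inv t s x : tab_inv s ((tab_perm t s)^-1%g x) = tab_inv t x.
Proof. by rewrite -[in RHS](permKV (tab_perm t s) x) tab_inv_perm. Qed.

Lemma tab_perm_comp r t s : tab_perm r t ** tab_perm t s = tab_perm r s.
Proof. by apply/permP => x; rewrite permM !permE tabK. Qed.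

Lemma col_stab_conj t s x :
  (tab_perm t s ** x ** (tab_perm t s)^-1%g \in col_stab t) = (x \in col_stab s).
Proof.
apply/col_stabP/col_stabP => H y.
  have := H (tab_perm t s y).
  by rewrite !permM permK !tab_inv_perm.
by rewrite !permM tab_inv_perm H tab_perm_inv.
Qed.

Lemma tab_comp_bij (s : 'S_n) t :
  injectiveb [ffun u => s (t u)] && [forall x, x \in codom [ffun u => s (t u)]].
Proof.
apply/andP; split.
  by apply/injectiveP => u v; rewrite !ffunE => /perm_inj/tab_inj.
apply/forallP => x; apply/codomP; exists (tab_inv t (s^-1%g x)).
by rewrite ffunE tab_invK permKV.
Qed.

Definition tab_comp (s : 'S_n) t : tableau l n := Tableau (tab_comp_bij s t).

Lemma tab_perm_compl (s : 'S_n) t r : tab_perm (tab_comp s t) r = s ** tab_perm t r.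
Proof. by apply/permP => x; rewrite permM !permE ffunE. Qed.

Lemma tab_perm_id t : tab_perm t t = 1%g.
Proof. by apply/permP => x; rewrite permE perm1 tab_invK. Qed.

End TableauInverse.

Section StandardTableau.
Variables (n : nat) (l : intpartition n).

Lemma std_tab_proof (u : node l) : (flatten_index l (nrow u) (ncol u) < n)%N.
Proof. rewrite -[X in (_ < X)%N](sumn_parts l); exact: flatten_indexP (ltn_ord (tagged u)). Qed.

(* flatten_index l i j is l_0 + ... + l_(i-1) + j *)
Definition std_tab_fun (u : node l) : 'I_n := Ordinal (std_tab_proof u).

Lemma std_tab_bij : injectiveb [ffun u => std_tab_fun u] &&
  [forall x, x \in codom [ffun u => std_tab_fun u]].
Proof.
apply/andP; split.
  apply/injectiveP=> -[i1 j1] [i2 j2]; rewrite !ffunE => /(congr1 val) /=.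
  rewrite /nrow /ncol /= => e.
  have ei: i1 = i2.
    apply: val_inj; move: (congr1 (reshape_index l) e).
    by rewrite !flatten_indexKl //=.
  case: _ / ei j2 e => j2 e; apply: (congr1 (existT _ i1)); apply: val_inj.
  by move: (congr1 (reshape_offset l) e); rewrite !flatten_indexKr //=.
apply/forallP=> x; apply/codomP.
have ltx : (x < sumn l)%N by rewrite sumn_parts.
pose i := Ordinal (reshape_indexP ltx).
have hj : (reshape_offset l x < nth 0%N l i)%N by exact: reshape_offsetP.
exists (@existT _ (fun i : 'I_(size l) => 'I_(nth 0%N l i)) i (Ordinal hj)).
by rewrite ffunE; apply: val_inj; rewrite /= reshape_indexK.
Qed.

Definition std_tab : tableau l n := Tableau std_tab_bij.

Lemma std_row_stab (t : tableau l n) h : h \in young_shift n 0 l ->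
  tab_perm t std_tab ** h ** (tab_perm t std_tab)^-1%g \in row_stab t.
Proof.
have std_rowE y : nrow (tab_inv std_tab y) = reshape_index l y.
  rewrite -{2}(tab_invK std_tab y) ffunE /= flatten_indexKl //.
  exact: ltn_ord (tagged _).
move=> /young_shiftP Hh; apply/row_stabP => x.
rewrite !permM tab_inv_perm -[in RHS](tab_perm_inv t std_tab) !std_rowE.
have := Hh ((tab_perm t std_tab)^-1%g x).
by rewrite /= add0n sumn_parts ltn_ord !subn0 => /andP[_ /eqP].
Qed.

End StandardTableau.

(* The colour c_(i+1) is inl i, the colour d_(j+1) is inr j. *)

Definition colour := (nat + nat)%type.

Definition is_c (c : colour) : bool := if c is inl _ then true else false.

Definition leq_colour (c c' : colour) : bool :=
  match c, c' with
  | inl i, inl j => (i <= j)%N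
  | inl _, inr _ => true
  | inr _, inl _ => false
  | inr i, inr j => (i <= j)%N
  end.

Section ColouredTableaux.
Variables (l : seq nat) (n : nat) (ab : bicomposition n).
Local Notation a := (cpart ab).
Local Notation b := (dpart ab).
Implicit Types T : node l -> colour.

Definition has_type T : bool :=
  [&& [forall u, match T u with inl i => (i < size a)%N
                              | inr j => (j < size b)%N end],
      [forall i : 'I_(size a), #|[set u | T u == inl (val i)]| == nth 0%N a i]
    & [forall j : 'I_(size b), #|[set u | T u == inr (val j)]| == nth 0%N b j]].

Definition semistandard T : bool :=
  [forall u, forall v,
    [&& (nrow u == nrow v) && (ncol u <= ncol v)%N ==> leq_colour (T u) (T v),
        (ncol u == ncol v) && (nrow u <= nrow v)%N ==> leq_colour (T u) (T v),
        [&& u != v, nrow u == nrow v & T u == T v] ==> is_c (T u)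
      & [&& u != v, ncol u == ncol v & T u == T v] ==> ~~ is_c (T u)]].

Definition sstd T : bool := has_type T && semistandard T.

Variable t0 : tableau l n.

Definition T0 (u : node l) : colour :=
  if (t0 u < sumn a)%N then inl (reshape_index a (t0 u))
  else inr (reshape_index b (t0 u - sumn a)).

Definition act_tab (s : 'S_n) T : node l -> colour :=
  fun u => T (tab_inv t0 (s^-1%g (t0 u))).

Definition Td (d : 'S_n) := act_tab d T0.

Definition Gamma_sstd (Gamma : {set 'S_n}) : {set 'S_n} :=
  [set d in Gamma | sstd (Td d)].

Definition sgnz (s : 'S_n) : int := (-1) ^+ odd_perm s.

Definition good : {set 'S_n} :=
  [set d : 'S_n |
    [set d^-1%g ** r ** d | r in row_stab t0] :&: young_cd ab \subset young_c ab].

Definition dcoset (d : 'S_n) : {set 'S_n} :=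
  [set r ** d ** h | r in row_stab t0, h in young_cd ab].

(* The value of eps d at r ** d ** xa ** xb is sgn(xb), where xb = xi_beta^{+|alpha|}
   has the same sign as xi_beta; see epsE below for the independence of the
   chosen decomposition when d is in good. *)
Definition eps (d x : 'S_n) : int :=
  if [pick p : 'S_n * 'S_n * 'S_n |
        [&& p.1.1 \in row_stab t0, p.1.2 \in young_c ab, p.2 \in young_d ab
          & x == p.1.1 ** d ** p.1.2 ** p.2]] is Some p
  then sgnz p.2 else 0.

Definition acoef (d d' : 'S_n) : int :=
  \sum_(s in col_stab t0 | s ** d \in dcoset d') sgnz s * eps d' (s ** d).

Lemma epsE d r xa xb : d \in good -> r \in row_stab t0 -> xa \in young_c ab ->
  xb \in young_d ab -> eps d (r ** d ** xa ** xb) = sgnz xb.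
Proof.
rewrite inE => /subsetP Gd Rr Sa Sb; rewrite /eps; case: pickP => [|/(_ (r, xa, xb))].
  case=> -[r' a'] b' /and4P[/= Rr' Sa' Sb' /eqP e]; congr sgnz.
  have bb : (b'^-1 * xb)%g \in young_d ab by rewrite groupM ?groupV.
  have aa : (a'^-1 * xa)%g \in young_c ab by rewrite groupM ?groupV.
  have e2 : (a'^-1 * xa * (b'^-1 * xb) = d * (r' * r^-1) * d^-1)%g.
    rewrite -[LHS]mulgA (young_cdC Sa bb).
    apply: (canRL (mulgK d)); rewrite [RHS]mulgA; apply: (canRL (mulgK r)).
    by rewrite -!mulgA e /= !mulKg.
  have : (b'^-1 * xb)%g \in young_c ab.
    rewrite -(groupMl _ aa); apply: Gd; rewrite inE; apply/andP; split.
      apply/imsetP; exists (r' * r^-1)%g; first by rewrite groupM ?groupV.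
      by rewrite e2 -mulgA.
    apply/imset2P; exists (a'^-1 * xa)%g (b'^-1 * xb)%g => //.
    exact: young_cdC aa bb.
  by move/young_cd1/(_ bb)/(canRL (mulKg _)); rewrite mulg1 invgK.
by rewrite Rr Sa Sb eqxx.
Qed.

Lemma dcosetP d x :
  reflect (exists r xa xb, [/\ r \in row_stab t0, xa \in young_c ab,
             xb \in young_d ab & x = r ** d ** xa ** xb]) (x \in dcoset d).
Proof.
apply: (iffP imset2P) => [[r h Rr /imset2P[xa xb Sa Sb ->] ->]|].
  by exists r, xa, xb; split; rewrite ?mulgA.
case=> r [xa [xb [Rr Sa Sb ->]]]; exists r (xb * xa)%g; rewrite // ?mulgA //.
by apply/imset2P; exists xa xb.
Qed.

Lemma eps_out d x : x \notin dcoset d -> eps d x = 0.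
Proof.
move=> Nx; rewrite /eps; case: pickP => // -[[r xa] xb] /= /and4P[Rr Sa Sb /eqP e].
by case/dcosetP: Nx; exists r, xa, xb.
Qed.

Lemma eps_row d r x : d \in good -> r \in row_stab t0 -> eps d (r ** x) = eps d x.
Proof.
move=> Gd Rr; have [/dcosetP[r' [xa [xb [Rr' Sa Sb ->]]]]|Nx] := boolP (x \in dcoset d).
  rewrite epsE // -(epsE Gd (groupM Rr' Rr) Sa Sb); congr eps.
  by rewrite !mulgA.
rewrite !eps_out //; apply: contra Nx => /dcosetP[r' [xa [xb [Rr' Sa Sb e]]]].
apply/dcosetP; exists (r' * r^-1)%g, xa, xb; split; rewrite ?groupM ?groupV //.
by rewrite !mulgA; apply: (canRL (mulgK r)); rewrite e !mulgA.
Qed.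

Lemma acoefE d d' :
  acoef d d' = \sum_(s in col_stab t0) sgnz s * eps d' (s ** d).
Proof.
rewrite /acoef [RHS](bigID (fun s => s ** d \in dcoset d')) /= [X in _ + X]big1 ?addr0 //.
by move=> s /andP[_ /eps_out ->]; rewrite mulr0.
Qed.

End ColouredTableaux.

Definition lin_ext (F : fieldType) (I : finType) (V : lmodType F) (g : I -> V)
  (v : {ffun I -> F^o}) : V := \sum_i v i *: g i.

Lemma lin_extE (F : fieldType) (I : finType) (V : vectType F) (g : I -> V) v :
  linfun (lin_ext g) v = lin_ext g v.
Proof.
have lin : linear (lin_ext g).
  move=> k u w; rewrite /lin_ext scaler_sumr -big_split /=.
  by apply: eq_bigr => i _; rewrite !ffunE scalerDl scalerA.
pose G : {linear {ffun I -> F^o} -> V} :=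
  HB.pack (lin_ext g) (GRing.isLinear.Build F _ _ _ _ lin).
exact: (lfunE G).
Qed.

Section Hom.
Variables (F : fieldType) (n : nat) (U V : vectType F).
Variables (rU : 'S_n -> 'End(U)) (rV : 'S_n -> 'End(V)).

(* the equivariant maps, see HomSP *)
Definition HomS : {vspace 'Hom(U, V)} :=
  (\bigcap_(s : 'S_n)
     lker (linfun (fun f : 'Hom(U, V) => (rV s \o f)%VF - (f \o rU s)%VF)))%VS.

Lemma HomSP (f : 'Hom(U, V)) :
  reflect (forall s u, f (rU s u) = rV s (f u)) (f \in HomS).
Proof.
have kerE s : (f \in lker (linfun (fun f : 'Hom(U, V) =>
    (rV s \o f)%VF - (f \o rU s)%VF))) = ((rV s \o f)%VF == (f \o rU s)%VF).
  have lin : linear (fun f : 'Hom(U, V) => (rV s \o f)%VF - (f \o rU s)%VF).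
    move=> k g h; apply/lfunP => u; do !rewrite !lfunE /=.
    by rewrite linearP scalerBr opprD addrACA.
  pose LM := GRing.isLinear.Build F _ _ _ _ lin.
  pose phi : {linear _ -> _} := HB.pack (fun f : 'Hom(U, V) =>
    (rV s \o f)%VF - (f \o rU s)%VF) LM.
  by rewrite memv_ker (lfunE phi) subr_eq0.
rewrite memvE; apply: (iffP (subv_bigcapP)) => [H s u | H s _].
  by have := H s isT; rewrite -memvE kerE => /eqP/lfunP/(_ u); rewrite !lfunE.
by rewrite -memvE kerE; apply/eqP/lfunP => u; rewrite !lfunE /= H.
Qed.

End Hom.

Section Specht.
Variables (F : fieldType) (n : nat) (l : intpartition n).

Definition left_coset (x : 'S_n) : {set 'S_n} :=
  [set x ** h | h in young_shift n 0 l].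

Definition cosets : {set {set 'S_n}} := [set left_coset x | x : 'S_n].

Definition permM := {ffun {C | C \in cosets} -> F^o}.
HB.instance Definition _ := Vector.on permM.

Definition pbasis (C : {set 'S_n}) : permM :=
  [ffun D : {C | C \in cosets} => (val D == C)%:R].

Definition permM_act (s : 'S_n) : 'End(permM) :=
  linfun (lin_ext (fun C : {C | C \in cosets} => pbasis [set s ** x | x in val C])).

Lemma permM_actE s x :
  permM_act s (pbasis (left_coset x)) = pbasis (left_coset (s ** x)).
Proof.
have Cx : left_coset x \in cosets by apply: imset_f.
rewrite lin_extE /lin_ext (bigD1 (Sub (left_coset x) Cx)) //= ffunE eqxx scale1r.
rewrite big1 ?addr0 => [|C ne]; last by rewrite ffunE (negPf (_ : val C != _)) ?scale0r.
by congr pbasis; rewrite -imset_comp; apply: eq_imset => h /=; rewrite mulgA.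
Qed.

Definition polytabloid (t : tableau l n) : permM :=
  \sum_(s in col_stab t)
     (-1) ^+ odd_perm s *: pbasis (left_coset (s ** tab_perm t (std_tab l))).

Definition polytabloids : #|{: tableau l n}|.-tuple permM :=
  [tuple polytabloid (enum_val i) | i < #|{: tableau l n}|].

Definition specht : {vspace permM} := <<polytabloids>>%VS.
Definition spechtM := subvs_of specht.
HB.instance Definition _ := Vector.on spechtM.

Definition specht_gen (t : tableau l n) : spechtM := vsproj specht (polytabloid t).

(* vsproj loses nothing since the span is stable, see specht_actE *)
Definition specht_act (s : 'S_n) : 'End(spechtM) :=
  linfun (fun v : spechtM => vsproj specht (permM_act s (vsval v))).

Lemma specht_genK t : vsval (specht_gen t) = polytabloid t.
Proof.
apply: vsprojK; apply: memv_span; apply/mapP; exists (enum_rank t).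
  by rewrite mem_enum.
by rewrite enum_rankK.
Qed.

Lemma polytabloid_act s t :
  permM_act s (polytabloid t) = polytabloid (tab_comp s t).
Proof.
rewrite linear_sum /polytabloid [RHS](reindex_inj (conjg_inj s)) /=.
have sE : tab_perm (tab_comp s t) t = s by rewrite tab_perm_compl tab_perm_id mul1g.
apply: eq_big => [x|x _].
  by rewrite -(col_stab_conj (tab_comp s t)) sE conjgE.
rewrite linearZ /= permM_actE odd_permJ; congr (_ *: pbasis (left_coset _)).
by rewrite tab_perm_compl conjgE !mulgA mulgK.
Qed.

Lemma specht_actE s (v : spechtM) : vsval (specht_act s v) = permM_act s (vsval v).
Proof.
have st : (permM_act s @: specht <= specht)%VS.
  rewrite limg_span; apply/span_subvP => _ /mapP[_ /mapP[i _ ->] ->].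
  by rewrite polytabloid_act -specht_genK subvsP.
have lin : linear (fun v : spechtM => vsproj specht (permM_act s (vsval v))).
  by move=> k u w; rewrite !linearP.
pose G : {linear spechtM -> spechtM} :=
  HB.pack (fun v : spechtM => vsproj specht (permM_act s (vsval v)))
    (GRing.isLinear.Build F _ _ _ _ lin).
rewrite [specht_act s v](lfunE G) /= vsprojK //.
by apply: (subvP st); rewrite memv_img ?subvsP.
Qed.

End Specht.

Section SignedYoung.
Variables (F : fieldType) (n : nat) (ab : bicomposition n) (Gamma : {set 'S_n}).

(* Ind(1 x sgn), as the vector space with basis Gamma; see tens_sgn, tens_basis and
   syM_actE for the defining relations of the induced module. *)
Definition syM := {ffun {d | d \in Gamma} -> F^o}.
HB.instance Definition _ := Vector.on syM.

(* x (x) 1 (x) epsilon in the basis d (x) 1 (x) epsilon, d in Gamma: if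
   x = d ** xa ** xb then it is sgn(xb) times the basis vector of d. *)
Definition tens (x : 'S_n) : syM :=
  [ffun d : {d | d \in Gamma} =>
    \sum_(p : 'S_n * 'S_n | [&& p.1 \in young_c ab, p.2 \in young_d ab
                              & x == val d ** p.1 ** p.2]) (-1) ^+ odd_perm p.2].

Definition syM_act (s : 'S_n) : 'End(syM) :=
  linfun (lin_ext (fun d : {d | d \in Gamma} => tens (s ** val d))).

Lemma tens_sgn x xa xb : xa \in young_c ab -> xb \in young_d ab ->
  tens (x ** xa ** xb) = (-1) ^+ odd_perm xb *: tens x.
Proof.
move=> Sa Sb; apply/ffunP => d; rewrite !ffunE scaler_sumr.
rewrite (reindex (fun q : 'S_n * 'S_n => (q.1 ** xa, q.2 ** xb))) /=; last first.
  by exists (fun q => (q.1 ** xa^-1%g, q.2 ** xb^-1%g)) => -[q1 q2] _ /=;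
    rewrite !mulgA ?mulVg ?mulgV !mul1g.
apply: eq_big => [[q1 q2]|[q1 q2] _] /=; last by rewrite odd_permM signr_addb.
rewrite !groupMl //; case: (boolP (q1 \in _)) => //= Sq1.
case: (boolP (q2 \in _)) => //= Sq2.
rewrite -!mulgA (inj_eq (mulgI _)) (mulgA q2 xa) -(young_cdC Sa Sq2) -mulgA.
by rewrite (inj_eq (mulgI _)).
Qed.

Hypothesis GammaP : left_transversal (young_cd ab) Gamma.

Lemma tens_basis d0 : d0 \in Gamma ->
  tens d0 = [ffun d : {d | d \in Gamma} => (val d == d0)%:R].
Proof.
move=> Gd0; apply/ffunP => d; rewrite !ffunE; have [->|ne] := eqVneq.
  rewrite (bigD1 (1%g, 1%g)) /=; last by rewrite !group1 !mul1g eqxx.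
  rewrite odd_perm1 expr0.
  rewrite big1 ?addr0 // => -[a b] /= /andP[/and3P[Sa Sb]].
  rewrite mulgA -{1}[d0]mul1g (inj_eq (mulIg _)) eq_sym => /eqP e /eqP[].
  have eb : b = a^-1%g by rewrite -[b](mulgK a) e mul1g.
  have b1 : b = 1%g by apply: (@young_cd1 _ ab _ _ Sb); rewrite eb groupV.
  by move: e; rewrite b1 mul1g => ->.
rewrite big1 // => -[a b] /= /and3P[Sa Sb /eqP e].
have [g [_ uni]] := GammaP d0; case/eqP: ne.
rewrite -(uni d0); last first.
  split=> //; exists 1%g; rewrite ?mul1g //.
  by apply/imset2P; exists 1%g 1%g; rewrite ?group1 ?mulg1.
apply/esym/uni; split; first exact: valP.
by exists (b * a)%g; rewrite -?mulgA //; apply/imset2P; exists a b.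
Qed.

Lemma syM_actE s x : syM_act s (tens x) = tens (s ** x).
Proof.
have [d [[Gd [h /imset2P[a b Sa Sb ->] ->]] _]] := GammaP x.
rewrite -!mulgA tens_sgn // tens_sgn //.
rewrite linearZ; congr (_ *: _); rewrite tens_basis // [LHS]lin_extE /lin_ext.
rewrite (bigD1 (Sub d Gd)) //= ffunE eqxx scale1r big1 ?addr0 // => e ne.
by rewrite ffunE (negPf (_ : val e != _)) ?scale0r.
Qed.

End SignedYoung.

Section Theta.
Variables (F : fieldType) (n : nat) (l : intpartition n) (ab : bicomposition n).
Variables (t0 : tableau l n) (Gamma : {set 'S_n}).

Definition theta_val (d' : 'S_n) (t : tableau l n) : syM F Gamma :=
  \sum_(d in Gamma)
    (acoef ab t0 ((tab_perm t t0)^-1%g ** d) d')%:~R *: tens F ab Gamma d.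

(* The linear map with e_t |-> theta_val d' t, by expanding along the spanning
   family of polytabloids; see theta_genE for the value at every e_t. *)
Definition theta (d' : 'S_n) : 'Hom(spechtM F l, syM F Gamma) :=
  linfun (fun v : spechtM F l => \sum_i
    coord (polytabloids F l) i (vsval v) *: theta_val d' (enum_val i)).

Lemma theta_genE d' t : d' \in good ab t0 ->
  theta d' (specht_gen F t) = theta_val d' t.
Proof.
move=> Gd'; pose d0 := tab_perm t0 (std_tab l).
pose g x : syM F Gamma := \sum_(d in Gamma)
  (eps ab t0 d' (d0 ** x^-1%g ** d))%:~R *: tens F ab Gamma d.
pose h (v : permM F l) : syM F Gamma :=
  lin_ext (fun C : {C | C \in cosets l} => g (repr (val C))) v.
have h_lin : linear h.
  move=> k u v; rewrite /h /lin_ext scaler_sumr -big_split /=.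
  by apply: eq_bigr => C _; rewrite !ffunE scalerDl scalerA.
pose H : {linear permM F l -> syM F Gamma} :=
  HB.pack h (GRing.isLinear.Build F _ _ _ _ h_lin).
have g_coset x y : y \in young_shift n 0 l -> g (x ** y) = g x.
  move=> Sy; apply: eq_bigr => d _; congr (_%:~R *: _).
  rewrite -(eps_row _ Gd' (std_row_stab t0 Sy)) -/d0; congr eps.
  by rewrite invMg !mulgA mulgK ?mulgKV.
have hE x : H (pbasis F l (left_coset l x)) = g x.
  have Cx : left_coset l x \in cosets l by apply: imset_f.
  rewrite /= /h /lin_ext (bigD1 (Sub (left_coset l x) Cx)) //= ffunE eqxx scale1r.
  rewrite big1 ?addr0 => [|C ne]; last first.
    by rewrite ffunE (negPf (_ : val C != _)) ?scale0r.
  have /imsetP[y Sy ->] : repr (left_coset l x) \in left_coset l x.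
    by apply: (mem_repr x); apply/imsetP; exists 1%g; rewrite ?group1 ?mul1g.
  exact: g_coset.
have hpoly s : H (polytabloid F s) = theta_val d' s.
  rewrite linear_sum /theta_val.
  under eq_bigr do rewrite linearZZ hE /g scaler_sumr.
  rewrite exchange_big; apply: eq_bigr => d _ /=; rewrite acoefE.
  under eq_bigr do rewrite scalerA.
  rewrite -scaler_suml rmorph_sum; congr (_ *: _).
  pose rho := tab_perm s t0.
  rewrite (reindex (fun x => rho ** x^-1%g ** rho^-1%g)) /=; last first.
    exists (fun x => rho^-1%g ** x^-1%g ** rho) => x _;
      by rewrite !invMg !invgK !mulgA ?mulgV ?mulVg ?mul1g ?mulgK ?mulgKV.
  apply: eq_big => x; first by rewrite col_stab_conj groupV.
  move=> _; rewrite rmorphM /sgnz rmorph_sign; congr (_ * _).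
    by rewrite !odd_permM !odd_permV addbCA addbb addbF.
  congr (_%:~R); congr eps.
  rewrite -(tab_perm_comp s t0 (std_tab l)) -/rho -/d0 !invMg !invgK.
  by rewrite !mulgA ?mulgKV ?mulgK.
rewrite /theta.
have th_lin : linear (fun v : spechtM F l => \sum_i
    coord (polytabloids F l) i (vsval v) *: theta_val d' (enum_val i)).
  move=> k u v; rewrite scaler_sumr -big_split /=.
  by apply: eq_bigr => i _; rewrite !linearP scalerDl scalerA.
pose TH : {linear spechtM F l -> syM F Gamma} :=
  HB.pack (fun v : spechtM F l => \sum_i
    coord (polytabloids F l) i (vsval v) *: theta_val d' (enum_val i))
    (GRing.isLinear.Build F _ _ _ _ th_lin).
rewrite (lfunE TH) /= -hpoly specht_genK.
have {2}-> := coord_span (_ : polytabloid F t \in <<polytabloids F l>>%VS); last first.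
  by rewrite -specht_genK subvsP.
rewrite linear_sum; apply: eq_bigr => i _.
by rewrite linearZZ -hpoly -(tnth_nth 0) tnth_mktuple.
Qed.

End Theta.

(* Main.v *)
(* Everything is read off from v = f (e_t0), seen as a function V on S_n by sycoef.

   A homomorphism is determined by V, and V is alternating under the column stabiliser
   and is killed by the Garnir sums over all permutations of a set Z that is too large
   to meet every row at most once.  Choose x in the support of V that maximizes first
   the sum of column * colour over the nodes of T_x, and then the sum of row * colour.
   Then the columns of T_x are sorted, and a violation in a row would give a Garnir
   sum equal to V x times a product of subgroup orders divided by another, which is
   invertible in F.  Hence V is determined by its values at the semistandard d, so that
   dim Hom <= |Gamma_sstd|.

   Conversely the value at d of the map attached to d' is acoef d d'.  By the
   rearrangement inequality in the columns, it vanishes for semistandard d and d'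
   unless d = d' or the sum of row * colour is smaller for T_d' than for T_d, and
   acoef d d is the order of a subgroup, so that the matrix is triangular and
   invertible.

   Semisimplicity is used only through n! <> 0 in F: an equivariant projection onto
   the sum of all the group elements multiplies it by a multiple of the order. *)
Require Import Defs.
From HB Require Import structures.
From mathcomp Require Import all_boot all_order all_algebra all_fingroup.
From mathcomp Require Import all_solvable all_field all_character.

Set Implicit Arguments.
Unset Strict Implicit.
Unset Printing Implicit Defensive.

Import GroupScope Order.TTheory GRing.Theory Num.Theory.
Local Open Scope ring_scope.

(** * Semisimplicity and rearrangements *)

Lemma semisimple_natf_card (F : fieldType) (gT : finGroupType) (G : {group gT}) :
  mxsemisimple (regular_repr F G) 1%:M -> #|G|%:R != 0 :> F.
Proof.
move=> ssG; pose rG := regular_repr F G.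
pose u : 'rV[F]_#|G| := const_mx 1.
have u_inv x : x \in G -> u *m rG x = u.
  move=> Gx; apply/rowP=> j; rewrite !mxE.
  under eq_bigr do rewrite !mxE mul1r eqxx /=.
  rewrite (bigD1 (gring_index G (enum_val j * x^-1))) //= big1 => [|i].
    by rewrite gring_indexK ?groupM ?groupV ?enum_valP // mulgKV gring_valK eqxx addr0.
  move=> ne; case: eqP => // e; case/eqP: ne; rewrite e gring_indexK ?groupM ?enum_valP //.
  by rewrite mulgK gring_valK.
have mod_u : mxmodule rG <<u>>%MS.
  by apply/mxmoduleP=> x Gx; rewrite (eqmxMr _ (genmxE u)) u_inv ?genmxE.
have [W modW defV dxV] := mxsemisimple_reducible ssG mod_u (submx1 _).
have {}dxV : (<<u>> :&: W = 0)%MS by apply/mxdirect_addsP.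
pose p := proj_mx <<u>>%MS W.
have p_hom x : x \in G -> rG x *m p = p *m rG x.
  have /hom_mxP/(_ x) : (1%:M <= dom_hom_mx rG p)%MS.
    by rewrite -defV; exact: proj_mx_hom.
  by rewrite !mul1mx.
pose e1 : 'rV[F]_#|G| := delta_mx 0 (gring_index G 1).
(* The translates of the basis vector of the identity sum to [u], so the one scalar [c] determines
   [u *m p]. *)
have [c e_p] : exists c, e1 *m p = c *: u.
  by apply/sub_rVP; rewrite -(genmxE u); exact: proj_mx_sub.
have upE : u *m p = (#|G|%:R * c) *: u.
  have uE : u = \sum_(x in G) e1 *m rG x.
    rewrite (big_enum_val (fun x => e1 *m rG x)) /=.
    rewrite [LHS]row_sum_delta; apply: eq_bigr => i _.
    rewrite -rowE rowK gring_indexK ?group1 // mul1g gring_valK.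
    by rewrite mxE scale1r.
  rewrite {1}uE mulmx_suml; under eq_bigr do rewrite -mulmxA p_hom // mulmxA e_p -scalemxAl.
  under eq_bigr => x Gx do rewrite u_inv //.
  by rewrite sumr_const mulrC -scalerA scaler_nat scalerMnr.
apply/eqP=> card0; move: upE; rewrite card0 mul0r scale0r proj_mx_id ?genmxE //.
by move/rowP/(_ (gring_index G 1)); rewrite !mxE; apply/eqP/oner_neq0.
Qed.

Section Rearrangement.
Variable T : finType.
Implicit Types (w f : T -> nat) (s : {perm T}).

Definition wsum w f : int := \sum_p (w p)%:Z * (f p)%:Z.

Lemma wsum_perm w f s : wsum w (fun p => f (s^-1 p)%g) = wsum (fun p => w (s p)) f.
Proof.
by rewrite /wsum (reindex_inj (@perm_inj _ s)) /=; under eq_bigr do rewrite permK.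
Qed.

(* m is free because w and its rearrangement have the same sum *)
Lemma wsum_permB w f s (m : int) :
  wsum (fun p => w (s p)) f - wsum w f
    = \sum_p ((w (s p))%:Z - (w p)%:Z) * ((f p)%:Z - m).
Proof.
under [RHS]eq_bigr do rewrite mulrBr.
rewrite sumrB -mulr_suml sumrB [X in (X - _) * m](reindex_inj (@perm_inj _ s^-1%g)) /=.
under [X in (X - _) * m]eq_bigr do rewrite permKV.
rewrite subrr mul0r subr0 -sumrB; by under [RHS]eq_bigr do rewrite mulrBl.
Qed.

Lemma wsum_tpermB w f p q :
  wsum (fun x => w (tperm p q x)) f - wsum w f
    = ((w q)%:Z - (w p)%:Z) * ((f p)%:Z - (f q)%:Z).
Proof.
(* Taking [m] to be [f q] also kills the term at [q], so only the term at [p] survives. *)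
rewrite (wsum_permB _ _ _ (f q)%:Z) (bigD1 p) //= tpermL big1 ?addr0 // => x.
case: tpermP => [-> /eqP //|-> _|_ _ _]; last by rewrite subrr mul0r.
by rewrite [X in _ * X]subrr mulr0.
Qed.

Variables cls rk : T -> nat.

(** Used twice: with rows as classes and column numbers as ranks, and the other way round. *)
Definition class_monotone f :=
  forall p q, cls p = cls q -> (rk p <= rk q)%N -> (f p <= f q)%N.

(** A class has only one sorted arrangement of given values. Where two of them differ, the smaller
    value [v] at that point is a threshold: the points of the class with value at most [v] form
    nested sets, one strictly inside the other, although [s] maps one onto the other. *)
Lemma class_monotone_uniq f f' s : (forall p, cls (s p) = cls p) ->
  (forall p, f' (s p) = f p) -> class_monotone f -> class_monotone f' -> f =1 f'.
Proof.
have half g g' (r : {perm T}) : (forall p, cls (r p) = cls p) -> (forall p, g' (r p) = g p) ->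
    class_monotone g -> class_monotone g' -> forall p, (g' p <= g p)%N.
  move=> rC rE mg mg' p; rewrite leqNgt; apply/negP => lt_gp.
  pose A h := [set q | (cls q == cls p) && (h q <= g p)%N].
  have AE : r @: A g = A g'.
    apply/setP=> q; rewrite -[q](permKV r) mem_imset ?inE ?rC ?rE //.
    exact: perm_inj.
  suff /proper_card : A g' \proper A g.
    by rewrite -AE card_imset ?ltnn //; exact: perm_inj.
  rewrite properE; apply/andP; split; last first.
    by apply/subsetPn; exists p; rewrite !inE eqxx ?leqnn //= -ltnNge.
  apply/subsetP=> q; rewrite !inE => /andP[/eqP cq le_q]; rewrite cq eqxx /=.
  apply: mg => //; rewrite leqNgt; apply/negP=> lt_pq.
  by have := mg' _ _ (esym cq) (ltnW lt_pq); rewrite leqNgt (leq_ltn_trans le_q).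
move=> sC sE mf mf' p; apply/eqP; rewrite eqn_leq.
rewrite (half _ _ _ sC sE mf mf') andbT; apply: (half f' f s^-1%g) => // q.
  by rewrite -[in RHS](permKV s q) sC.
by rewrite -sE permKV.
Qed.

Hypothesis cls_rk_inj : forall p q, cls p = cls q -> rk p = rk q -> p = q.

(** The rearrangement inequality within classes. Swapping an inversion increases the sum, so every
    maximizing rearrangement is sorted and thus equals [f]; this also settles the case of
    equality. *)
Lemma class_monotone_wsum f s : (forall p, cls (s p) = cls p) ->
  class_monotone f ->
  wsum rk (fun p => f (s^-1 p)%g) <= wsum rk f ?= iff [forall p, f (s^-1 p)%g == f p].
Proof.
move=> sC mf.
pose P (t : {perm T}) := [forall p, cls (t p) == cls p].
pose W (t : {perm T}) := wsum rk (fun p => f (t^-1 p)%g).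
have maxW t : P t -> (forall t', P t' -> W t' <= W t) -> f =1 (fun p => f (t^-1 p)%g).
  move=> Pt maxt; have tC p := eqP (forallP Pt p).
  apply: (class_monotone_uniq tC) => // [p|p q clspq le_rk]; first by rewrite permK.
  rewrite leqNgt; apply/negP => lt_f.
  have lt_rk : (rk p < rk q)%N.
    rewrite ltn_neqAle le_rk andbT; apply: contraTneq lt_f => e.
    by rewrite (cls_rk_inj clspq e) ltnn.
  have : W (t * tperm p q)%g <= W t.
    apply: maxt; apply/forallP => x; rewrite permM -[X in _ == X]tC.
    by case: tpermP => // ->; rewrite clspq.
  rewrite -subr_le0 /W.
  have -> : wsum rk (fun x => f ((t * tperm p q)^-1 x)%g) =
            wsum (fun x => rk (tperm p q x)) (fun x => f (t^-1 x)%g).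
    rewrite -wsum_perm; apply: eq_bigr => x _.
    by rewrite invMg permM.
  rewrite wsum_tpermB leNgt => /negP[]; apply: mulr_gt0; rewrite subr_gt0 //.
have P1 : P 1%g by apply/forallP => x; rewrite perm1.
case: (@arg_maxP _ _ _ 1%g P W P1) => t Pt maxt.
have ft := maxW t Pt maxt.
have WtE : W t = wsum rk f by apply: eq_bigr => x _; rewrite -ft.
have Ps : P s by apply/forallP => x; rewrite sC.
split; first by rewrite -WtE; exact: maxt.
apply/eqP/forallP => [e p|e]; last by apply: eq_bigr => x _; rewrite (eqP (e x)).
by rewrite -(maxW s) // => t' Pt'; rewrite /W e -WtE; exact: maxt.
Qed.

End Rearrangement.

(** * Young subgroups and the signed permutation module *)

Section ColourClasses.
Variables (n : nat) (ab : bicomposition n).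
Local Notation a := (cpart ab).
Local Notation b := (dpart ab).
Implicit Types (x y : 'I_n) (s xa xb : 'S_n).

(* The rank of the colour of T_0 at the node labelled x in the order of the colours. *)
Definition colour_rank x : nat :=
  if (x < sumn a)%N then reshape_index a x
  else (size a + reshape_index b (x - sumn a))%N.

Lemma sumn_cd : (sumn a + sumn b)%N = n.
Proof. by case: ab => /= ? ? /and3P[_ _ /eqP]. Qed.

Lemma colour_rank_lt x : (colour_rank x < size a)%N = (x < sumn a)%N.
Proof.
rewrite /colour_rank; case: ifP => [/reshape_indexP //|_].
by rewrite ltnNge leq_addr.
Qed.

Lemma ltn_sub_d x : (sumn a <= x)%N -> (x - sumn a < sumn b)%N.
Proof. by move=> le_x; rewrite -(ltn_add2l (sumn a)) subnKC // sumn_cd. Qed.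

Lemma young_c_colour xa x : xa \in young_c ab -> colour_rank (xa x) = colour_rank x.
Proof.
move=> /young_shiftP/(_ x); rewrite /colour_rank /= add0n.
by case: ifP => [_ /andP[-> /eqP]|lt_x /eqP ->]; rewrite ?subn0 ?lt_x.
Qed.

Lemma young_d_colour xb x : xb \in young_d ab -> colour_rank (xb x) = colour_rank x.
Proof.
move=> /young_shiftP/(_ x); rewrite /colour_rank sumn_cd ltn_ord andbT leqNgt.
case: ifP => [lt_x /andP[/andP[le_x _] /eqP e]|_ /eqP -> //].
by rewrite (negPf lt_x) ltnNge le_x e.
Qed.

Lemma mem_young_c s : (forall x, colour_rank (s x) = colour_rank x) ->
  (forall x, (sumn a <= x)%N -> s x = x) -> s \in young_c ab.
Proof.
move=> sC sd; apply/young_shiftP=> x; rewrite /= add0n.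
case: ltnP => [lt_x|/sd ->//]; have := sC x.
have lt_sx : (s x < sumn a)%N by rewrite -colour_rank_lt sC colour_rank_lt.
by rewrite /colour_rank lt_x lt_sx !subn0 => ->; rewrite eqxx.
Qed.

Lemma mem_young_d s : (forall x, colour_rank (s x) = colour_rank x) ->
  (forall x, (x < sumn a)%N -> s x = x) -> s \in young_d ab.
Proof.
move=> sC sc; apply/young_shiftP=> x; rewrite sumn_cd !ltn_ord !andbT.
case: leqP => [le_x|/sc ->//]; have := sC x.
have lt_sx : (s x < sumn a)%N = false.
  by rewrite -colour_rank_lt sC colour_rank_lt ltnNge le_x.
have -> : (sumn a <= s x)%N by rewrite leqNgt lt_sx.
by rewrite /colour_rank lt_sx ltnNge le_x => /addnI ->; rewrite eqxx.
Qed.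

Lemma young_cd_split s : (forall x, colour_rank (s x) = colour_rank x) ->
  exists xa xb, [/\ xa \in young_c ab, xb \in young_d ab & s = xa ** xb].
Proof.
move=> sC; pose A := [set x : 'I_n | (x < sumn a)%N]; pose xa := restr_perm A s.
have sA x : (s x \in A) = (x \in A) by rewrite !inE -colour_rank_lt sC colour_rank_lt.
have nA : s \in 'N(A | 'P)%g.
  by rewrite !inE /=; apply/subsetP=> x Ax; rewrite inE /= apermE sA.
have xaC x : colour_rank (xa x) = colour_rank x.
  have [Ax|nAx] := boolP (x \in A); first by rewrite [xa x]restr_permE.
  by rewrite (out_perm (restr_perm_on A s)).
have Sxa : xa \in young_c ab.
  apply: mem_young_c => // x le_x; apply: (out_perm (restr_perm_on A s)).
  by rewrite inE -leqNgt.
exists xa, (s * xa^-1)%g; split; rewrite ?mulgKV //.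
apply: mem_young_d => x; rewrite perm.permM.
  by rewrite -xaC permKV sC.
move=> lt_x; apply: (canLR (permK xa)); rewrite [xa x]restr_permE //.
by rewrite inE.
Qed.

(** Stabilizing colours is visibly a subgroup condition, and it identifies left cosets with
    colourings. *)
Lemma young_cdP s :
  reflect (forall x, colour_rank (s x) = colour_rank x) (s \in young_cd ab).
Proof.
apply: (iffP imset2P) => [[xa xb Sa Sb ->] x|/young_cd_split[xa [xb [Sa Sb ->]]]].
  by rewrite perm.permM young_c_colour // young_d_colour.
by exists xa xb.
Qed.

Lemma young_cd_group : group_set (young_cd ab).
Proof.
apply/group_setP; split=> [|s t /young_cdP sC /young_cdP tC].
  by apply/young_cdP => x; rewrite perm1.
by apply/young_cdP => x; rewrite perm.permM tC sC.
Qed.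
Canonical young_cd_Group := Group young_cd_group.

Section Transversal.
Variable Gamma : {set 'S_n}.
Hypothesis GammaP : left_transversal (young_cd ab) Gamma.

Lemma transversal_split s : exists d xa xb,
  [/\ d \in Gamma, xa \in young_c ab, xb \in young_d ab & s = d ** xa ** xb].
Proof.
by have [d [[Gd [_ /imset2P[xa xb Sa Sb ->] ->]] _]] := GammaP s; exists d, xa, xb;
  split; rewrite ?mulgA.
Qed.

Lemma transversal_inj d e : d \in Gamma -> e \in Gamma ->
  (forall x, colour_rank (d^-1 x)%g = colour_rank (e^-1 x)%g) -> d = e.
Proof.
move=> Gd Ge de; have [g [_ uni]] := GammaP d; rewrite -(uni d); last first.
  by split=> //; exists 1%g; rewrite ?mul1g ?group1.
apply: uni; split=> //; exists (d * e^-1)%g; last by rewrite mulgKV.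
by apply/young_cdP => x; rewrite perm.permM -de permK.
Qed.

Variable F : fieldType.
Local Notation M := (syM F Gamma).

(* The coordinates of v with respect to all the x (x) 1 (x) epsilon, not just those
   of the basis: the function of x thus obtained is equivariant on both sides. *)
Definition sycoef (v : M) (s : 'S_n) : F := \sum_d v d * tens F ab Gamma s d.

Lemma sycoefD s u w : sycoef (u + w) s = sycoef u s + sycoef w s.
Proof. by rewrite /sycoef -big_split; apply: eq_bigr => d _; rewrite ffunE mulrDl. Qed.

Lemma sycoefZ s k w : sycoef (k *: w) s = k * sycoef w s.
Proof. by rewrite /sycoef mulr_sumr; apply: eq_bigr => d _; rewrite ffunE mulrA. Qed.

Lemma sycoef0 s : sycoef 0 s = 0.
Proof. by rewrite -(scale0r 0) sycoefZ mul0r. Qed.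

Lemma sycoef_sum s I (r : seq I) (P : pred I) (g : I -> M) :
  sycoef (\sum_(i <- r | P i) g i) s = \sum_(i <- r | P i) sycoef (g i) s.
Proof. exact: (big_morph (sycoef^~ s) (sycoefD s) (sycoef0 s)). Qed.

Lemma sycoef_basis v d (Gd : d \in Gamma) : sycoef v d = v (Sub d Gd).
Proof.
rewrite /sycoef (bigD1 (Sub d Gd)) //= tens_basis // ffunE eqxx mulr1.
rewrite big1 ?addr0 // => e ne; rewrite ffunE (negPf (_ : val e != _)) ?mulr0 //.
Qed.

Lemma sycoef_young v s xa xb : xa \in young_c ab -> xb \in young_d ab ->
  sycoef v (s ** xa ** xb) = (-1) ^+ odd_perm xb * sycoef v s.
Proof.
move=> Sa Sb; rewrite /sycoef tens_sgn // mulr_sumr; apply: eq_bigr => d _.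
by rewrite ffunE mulrCA.
Qed.

Lemma sycoef_inj v w : (forall d, d \in Gamma -> sycoef v d = sycoef w d) -> v = w.
Proof.
move=> vw; apply/ffunP => -[d Gd]; have := vw d Gd; rewrite !sycoef_basis.
by congr (_ = _); congr (_ _); apply: val_inj.
Qed.

(** For [s] in [Gamma] this is the definition of [tens], and both sides acquire the same sign when
    [s] is multiplied by [xa ** xb]. The condition on [p] depends only on [s^-1 ** t], which gives
    [sycoef_act]. *)
Lemma sycoef_tens s t : sycoef (tens F ab Gamma t) s =
  \sum_(p : 'S_n * 'S_n | [&& p.1 \in young_c ab, p.2 \in young_d ab
                            & t == s ** p.1 ** p.2]) (-1) ^+ odd_perm p.2.
Proof.
have [d [xa [xb [Gd Sa Sb ->]]]] := transversal_split s.
rewrite sycoef_young // sycoef_basis ffunE /= mulr_sumr.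
rewrite (reindex (fun q : 'S_n * 'S_n => (xa ** q.1, xb ** q.2))) /=; last first.
  by exists (fun q => (xa^-1%g ** q.1, xb^-1%g ** q.2)) => -[q1 q2] _ /=;
    rewrite ?mulgK ?mulgKV.
apply: eq_big => [[q1 q2]|[q1 q2] _] /=; last first.
  by rewrite odd_permM signr_addb mulrCA -signr_addb addbb mulr1.
rewrite !groupMr //; case: (boolP (q1 \in _)) => //= Sq1.
case: (boolP (q2 \in _)) => //= Sq2; congr (_ == _).
by rewrite -!mulgA (mulgA q1 xb) (young_cdC Sq1 Sb) -!mulgA.
Qed.

Lemma sycoef_act v s t : sycoef (syM_act F ab Gamma s v) t = sycoef v (s^-1%g ** t).
Proof.
have -> : v = \sum_d v d *: tens F ab Gamma (val d).
  apply: sycoef_inj => d Gd; rewrite sycoef_sum; under eq_bigr do rewrite sycoefZ.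
  rewrite (bigD1 (Sub d Gd)) //= big1 => [|e ne].
    by rewrite addr0 !(sycoef_basis _ Gd) tens_basis // ffunE eqxx mulr1.
  rewrite (sycoef_basis _ Gd) (tens_basis F GammaP (valP e)) ffunE /= eq_sym.
  by rewrite (negPf (_ : val e != _)) ?mulr0.
rewrite linear_sum !sycoef_sum; apply: eq_bigr => d _.
rewrite linearZ !sycoefZ; congr (_ * _).
rewrite [X in sycoef X _]syM_actE // !sycoef_tens; apply: eq_bigl => p; do 2![congr (_ && _)].
by rewrite -(inj_eq (mulIg s^-1%g)) mulgK !mulgA.
Qed.

End Transversal.
End ColourClasses.

(** * Fillings *)

Lemma card_block n k mu i : (k + sumn mu <= n)%N ->
  #|[set x : 'I_n | (k <= x < k + sumn mu)%N
                    && (reshape_index mu (x - k) == i)]| = nth 0%N mu i.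
Proof.
move=> le_n.
have lt_n (j : 'I_(nth 0%N mu i)) : (k + flatten_index mu i j < n)%N.
  by apply: leq_trans le_n; rewrite ltn_add2l flatten_indexP.
pose f j := Ordinal (lt_n j).
have f_inj : injective f.
  move=> j1 j2 /(congr1 val)/addnI e; apply: val_inj.
  by rewrite /= -[LHS](flatten_indexKr (ltn_ord j1)) e flatten_indexKr.
rewrite -[RHS]card_ord -(card_imset predT f_inj); apply: eq_card => x.
rewrite inE; apply/idP/imsetP => [/andP[/andP[le_x lt_x] /eqP xi]|[j _ ->]] /=.
  have lt_xk : (x - k < sumn mu)%N by rewrite -(ltn_add2l k) subnKC.
  have := reshape_offsetP lt_xk; rewrite xi => lt_j.
  exists (Ordinal lt_j) => //; apply: val_inj => /=.
  by rewrite -xi reshape_indexK subnKC.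
by rewrite leq_addr ltn_add2l flatten_indexP //= addKn flatten_indexKl.
Qed.

Section Labels.
Variables (n : nat) (l : intpartition n) (t : tableau l n).
Implicit Types (p q : 'I_n) (s : 'S_n).

(** Nodes are addressed by their labels, so that permutations act on them directly. *)
Definition lrow p := nrow (tab_inv t p).
Definition lcol p := ncol (tab_inv t p).

Lemma label_inj p q : lrow p = lrow q -> lcol p = lcol q -> p = q.
Proof.
rewrite /lrow /lcol => r c; rewrite -(tab_invK t p) -(tab_invK t q); congr (t _).
case: (tab_inv t p) (tab_inv t q) r c => [i j] [i' j']; rewrite /nrow /ncol /=.
move=> /val_inj e; case: _ / e j' => j' /val_inj -> //.
Qed.

Lemma label_ex i j : (i < size l)%N -> (j < nth 0%N l i)%N ->
  exists p, lrow p = i /\ lcol p = j.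
Proof.
move=> lt_i lt_j; pose u : node l :=
  @existT _ (fun i : 'I_(size l) => 'I_(nth 0%N l i)) (Ordinal lt_i) (Ordinal lt_j).
by exists (t u); rewrite /lrow /lcol tabK.
Qed.

Lemma label_left p j : (j <= lcol p)%N -> exists q, lrow q = lrow p /\ lcol q = j.
Proof.
move=> le_j; apply: label_ex; first exact: ltn_ord (tag _).
exact: leq_ltn_trans le_j (ltn_ord (tagged _)).
Qed.

Lemma label_up p i : (i <= lrow p)%N -> exists q, lrow q = i /\ lcol q = lcol p.
Proof.
move=> le_i; have lt_p : (lrow p < size l)%N := ltn_ord (tag _).
have lt_i := leq_ltn_trans le_i lt_p.
apply: label_ex => //; apply: leq_trans (ltn_ord (tagged _)) _.
have /andP[sl _] := intpartitionP l.
by apply: (sorted_leq_nth (rev_trans leq_trans) leqnn 0%N sl) => //; rewrite inE.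
Qed.

Variable ab : bicomposition n.
Local Notation a := (cpart ab).
Local Notation b := (dpart ab).

(* The rank of the colour of T_d at the node labelled p. *)
Definition filling (d : 'S_n) p : nat := colour_rank ab (d^-1 p)%g.

Lemma filling_perm s d p : filling (s ** d) (s p) = filling d p.
Proof. by rewrite /filling invMg perm.permM permK. Qed.

Lemma filling_young d h : h \in young_cd ab -> filling (d ** h) =1 filling d.
Proof.
by move=> /young_cdP hC p; rewrite /filling invMg perm.permM -hC permKV.
Qed.

Lemma filling_eqP d e :
  reflect (exists2 h, h \in young_cd ab & e = d ** h) [forall p, filling d p == filling e p].
Proof.
apply: (iffP forallP) => [de|[h Sh -> p]]; last by rewrite filling_young.
exists (e * d^-1)%g; last by rewrite mulgKV.
by apply/young_cdP=> x; rewrite perm.permM -[LHS]/(filling d (e x)) (eqP (de _)) /filling permK.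
Qed.

(** The colour at [p] is one of the c colours exactly when [d^-1 p] is below [sumn a]. *)
Definition sstd_filling (d : 'S_n) : Prop :=
  [/\ class_monotone lrow lcol (filling d), class_monotone lcol lrow (filling d),
      forall p q, p != q -> lrow p = lrow q -> filling d p = filling d q ->
        ((d^-1)%g p < sumn a)%N
    & forall p q, p != q -> lcol p = lcol q -> filling d p = filling d q ->
        (sumn a <= (d^-1)%g p)%N].

Lemma T0_leq u v : leq_colour (T0 ab t u) (T0 ab t v) =
  (colour_rank ab (t u) <= colour_rank ab (t v))%N.
Proof.
rewrite /T0 /colour_rank; case: ifP => lt_u; case: ifP => lt_v //=.
- by rewrite ltnW // ltn_addr // reshape_indexP.
- by rewrite leqNgt ltn_addr // reshape_indexP.
- by rewrite leq_add2l.
Qed.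

Lemma T0_eq u v : (T0 ab t u == T0 ab t v) =
  (colour_rank ab (t u) == colour_rank ab (t v)).
Proof.
rewrite eqn_leq -!T0_leq; case: (T0 ab t u) (T0 ab t v) =>  [i|i] [j|j] //=; rewrite -eqn_leq;
  by apply/eqP/eqP => [[]|->].
Qed.

Lemma is_c_T0 u : is_c (T0 ab t u) = (t u < sumn a)%N.
Proof. by rewrite /T0; case: ifP. Qed.

Lemma Td_has_type d : has_type ab (Td ab t d).
Proof.
have TdE u : Td ab t d u = T0 ab t (tab_inv t ((d^-1)%g (t u))) by [].
have card_Td (P : pred 'I_n) :
    #|[set u : node l | P ((d^-1)%g (t u))]| = #|[set x | P x]|.
  have inj : injective (fun u => (d^-1)%g (t u)) by move=> u v /perm_inj/tab_inj.
  rewrite -(card_imset _ inj); apply: eq_card => x; apply/imsetP/idP.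
    by case=> u; rewrite !inE => Pu ->.
  rewrite inE => Px; exists (tab_inv t (d x)); rewrite ?inE tab_invK permK //.
have T0E x : T0 ab t (tab_inv t x) =
    if (x < sumn a)%N then inl (reshape_index a x)
    else inr (reshape_index b (x - sumn a)) by rewrite /T0 tab_invK.
apply/and3P; split.
- apply/forallP => u; rewrite TdE T0E; case: ifPn => [/reshape_indexP //|].
  by rewrite -leqNgt => /ltn_sub_d/reshape_indexP.
- apply/forallP => i; apply/eqP; rewrite -(@card_block n 0 a i); last first.
    by rewrite -[X in (_ <= X)%N](sumn_cd ab) leq_addr.
  rewrite -card_Td; apply: eq_card => u; rewrite !inE TdE T0E add0n subn0 /=.
  by case: ifP.
apply/forallP => j; apply/eqP; rewrite -(@card_block n (sumn a) b j); last first.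
  by rewrite (sumn_cd ab).
rewrite -card_Td; apply: eq_card => u; rewrite !inE TdE T0E (sumn_cd ab) ltn_ord.
by rewrite andbT; case: ltnP.
Qed.

Lemma sstdP d : reflect (sstd_filling d) (sstd ab (Td ab t d)).
Proof.
rewrite /sstd Td_has_type /=.
have leE p q : leq_colour (Td ab t d (tab_inv t p)) (Td ab t d (tab_inv t q)) =
    (filling d p <= filling d q)%N by rewrite [LHS]T0_leq !tab_invK.
have eqE p q : (Td ab t d (tab_inv t p) == Td ab t d (tab_inv t q)) =
    (filling d p == filling d q) by rewrite [LHS]T0_eq !tab_invK.
have cE p : is_c (Td ab t d (tab_inv t p)) = ((d^-1)%g p < sumn a)%N.
  by rewrite [LHS]is_c_T0 !tab_invK.
have neE p q : (tab_inv t p != tab_inv t q) = (p != q).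
  by rewrite (inj_eq (can_inj (tab_invK t))).
apply: (iffP forallP) => [ss|[mr mc dr dc] u].
  have {}ss p q := forallP (ss (tab_inv t p)) (tab_inv t q).
  split=> p q; have /and4P[] := ss p q; rewrite leE eqE cE neE -/(lrow p) -/(lrow q)
    -/(lcol p) -/(lcol q) => /implyP s1 /implyP s2 /implyP s3 /implyP s4.
  - by move=> rpq cpq; apply: s1; rewrite rpq eqxx.
  - by move=> rpq cpq; apply: s2; rewrite rpq eqxx.
  - by move=> npq rpq fpq; apply: s3; rewrite npq rpq fpq !eqxx.
  - by move=> npq rpq fpq; rewrite leqNgt; apply: s4; rewrite npq rpq fpq !eqxx.
apply/forallP => v; rewrite -(tabK t u) -(tabK t v).
set p := t u; set q := t v; rewrite leE eqE cE neE -/(lrow p) -/(lrow q)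
    -/(lcol p) -/(lcol q); apply/and4P; split; apply/implyP.
- by move=> /andP[/eqP r c]; apply: mr.
- by move=> /andP[/eqP r c]; apply: mc.
- by move=> /and3P[npq /eqP r /eqP c]; apply: (dr p q).
- by move=> /and3P[npq /eqP r /eqP c]; rewrite -leqNgt; apply: (dc p q).
Qed.

(** If [d^-1 ** r ** d] preserves colours and moves [x], then [d x] and [r (d x)] are distinct
    labels of one row with equal colours, which is allowed only for a c colour. *)
Lemma sstd_filling_good d : sstd_filling d -> d \in good ab t.
Proof.
case=> _ _ dr _; rewrite inE; apply/subsetP => _ /setIP[/imsetP[r Rr ->]].
move=> /young_cdP hC; apply: mem_young_c => // x le_x; apply/eqP/negPn/negP => ne.
suff : (x < sumn a)%N by rewrite ltnNge le_x.
rewrite -[x](permK d); apply: (dr _ (r (d x))).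
- by apply: contra ne => /eqP e; rewrite !perm.permM -e permK.
- by rewrite /lrow (row_stabP _ _ Rr).
- by rewrite /filling permK -[LHS]hC !perm.permM.
Qed.

End Labels.

(** * Relations in the Specht module *)

Lemma tperm_Sym (T : finType) (S : {set T}) p q :
  p \in S -> q \in S -> tperm p q \in perm.Sym S.
Proof.
move=> Sp Sq; rewrite inE; apply/subsetP => z; rewrite inE.
by case: tpermP => [->|->|] //; rewrite eqxx.
Qed.

Section SpechtRelations.
Variables (F : fieldType) (n : nat) (l : intpartition n) (t : tableau l n).
Implicit Types (s g h x : 'S_n).

Lemma std_tab_row y : nrow (tab_inv (std_tab l) y) = reshape_index l y.
Proof.
rewrite -[in RHS](tab_invK (std_tab l) y) ffunE /= flatten_indexKl //.
exact: ltn_ord (tagged _).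
Qed.

Lemma left_coset_young x h : h \in young_shift n 0 l ->
  left_coset l (x ** h) = left_coset l x.
Proof.
move=> Sh; apply/setP=> y; apply/imsetP/imsetP => -[k Sk ->].
  by exists (k * h)%g; rewrite ?groupM ?mulgA.
by exists (k * h^-1)%g; rewrite ?groupM ?groupV // -!mulgA mulKg.
Qed.

Lemma left_coset_mull g x : left_coset l (g ** x) = [set g ** y | y in left_coset l x].
Proof. by rewrite /left_coset -imset_comp; apply: eq_imset => h /=; rewrite mulgA. Qed.

(** The labels [p] and [q] share a row of the tableau [x] o [t], so moving the transposition to the
    right of [x ** w] conjugates it into the Young subgroup of [l]. *)
Lemma left_coset_tperm x p q : lrow t (x^-1 p)%g = lrow t (x^-1 q)%g ->
  left_coset l (tperm p q ** x ** tab_perm t (std_tab l)) =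
  left_coset l (x ** tab_perm t (std_tab l)).
Proof.
set w := tab_perm t _ => rpq.
have -> : tperm p q ** x ** w = x ** w ** (tperm p q ^ (w * x)^-1)%g.
  by rewrite conjgE invgK -!mulgA mulVg mulg1.
apply: left_coset_young; rewrite tpermJ.
apply/young_shiftP => y; rewrite add0n sumn_parts !ltn_ord !subn0 /=.
have rE z : reshape_index l ((w * x)^-1 z)%g = lrow t (x^-1 z)%g.
  by rewrite -std_tab_row invMg perm.permM tab_perm_inv.
by apply/eqP; case: tpermP => // ->; rewrite !rE.
Qed.

Lemma polytabloid_col s : s \in col_stab t ->
  permM_act F l s (polytabloid F t) = (-1) ^+ odd_perm s *: polytabloid F t.
Proof.
move=> Cs; rewrite linear_sum /polytabloid scaler_sumr.
rewrite [RHS](reindex_inj (mulIg s)) /=; apply: eq_big => [x|x _].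
  by rewrite groupMr.
rewrite linearZ /= permM_actE scalerA odd_permM signr_addb mulrCA -signr_addb addbb.
by rewrite mulr1 mulgA.
Qed.

(* Each column permutation x of the tabloid of t leaves two elements p, q of Z in the
   same row, hence is fixed by the transposition (p q), which kills the alternating sum. *)
Lemma polytabloid_garnir (Z : {set 'I_n}) : 2%:R != 0 :> F ->
  (forall x, x \in col_stab t -> exists p q,
     [/\ p \in Z, q \in Z, p != q & lrow t (x^-1 p)%g = lrow t (x^-1 q)%g]) ->
  \sum_(g in perm.Sym Z) (-1) ^+ odd_perm g *: permM_act F l g (polytabloid F t) = 0.
Proof.
move=> nz2 ZP; under eq_bigr do rewrite linear_sum scaler_sumr.
rewrite exchange_big big1 //= => x Cx.
under eq_bigr do rewrite linearZ scalerA mulrC -scalerA /= permM_actE.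
rewrite -scaler_sumr; apply/eqP; rewrite scaler_eq0; apply/orP; right.
set S := \sum_(g in _) _; have [p [q [Zp Zq npq rpq]]] := ZP x Cx.
have Spq := tperm_Sym Zp Zq.
have SN : S = - S.
  rewrite {1}/S (reindex_inj (mulgI (tperm p q))) /= -sumrN.
  apply: eq_big => [g|g _]; first by rewrite groupMl.
  rewrite odd_permM odd_tperm npq signr_addb mulN1r scaleNr; congr (- (_ *: pbasis F l _)).
  by rewrite mulgA !(left_coset_mull g) -mulgA left_coset_tperm.
move/eqP: SN; rewrite -addr_eq0 -mulr2n -scaler_nat scaler_eq0.
by rewrite (negPf nz2).
Qed.

Lemma specht_act_gen s : specht_act F l s (specht_gen F t) = specht_gen F (tab_comp s t).
Proof.
apply: val_inj; rewrite [LHS]specht_actE specht_genK polytabloid_act.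
by rewrite [RHS]specht_genK.
Qed.

Lemma specht_genE (v : spechtM F l) :
  v = \sum_i coord (polytabloids F l) i (vsval v) *: specht_gen F (enum_val i).
Proof.
apply: val_inj; rewrite [LHS](coord_span (subvsP v)) linear_sum; apply: eq_bigr => i _.
rewrite [RHS]linearZ /= specht_genK; congr (_ *: _).
by rewrite -[LHS](tnth_nth 0 (polytabloids F l)) tnth_mktuple.
Qed.

End SpechtRelations.

(** * Relations for the coefficients of the image of a polytabloid *)

Section HomCoef.
Variables (F : fieldType) (n : nat) (l : intpartition n) (ab : bicomposition n).
Variables (t0 : tableau l n) (Gamma : {set 'S_n}).
Hypothesis GammaP : left_transversal (young_cd ab) Gamma.
Variable f : 'Hom(spechtM F l, syM F Gamma).
Hypothesis f_hom : f \in HomS (specht_act F l) (syM_act F ab Gamma).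
Local Notation V := (sycoef ab (f (specht_gen F t0))).

Lemma hom_sycoef_act s x : sycoef ab (f (specht_act F l s (specht_gen F t0))) x = V (s^-1%g ** x).
Proof. by rewrite (HomSP _ _ _ f_hom) sycoef_act. Qed.

Lemma hom_sycoef_col s x : s \in col_stab t0 -> V (s ** x) = (-1) ^+ odd_perm s * V x.
Proof.
move=> Cs; rewrite -[s in LHS]invgK -hom_sycoef_act -sycoefZ -linearZ; congr (sycoef _ (f _) _).
apply: val_inj; rewrite [LHS]specht_actE linearZ /= !specht_genK.
by rewrite polytabloid_col ?groupV // odd_permV.
Qed.

Lemma hom_sycoef_garnir (Z : {set 'I_n}) x : 2%:R != 0 :> F ->
  (forall s, s \in col_stab t0 -> exists p q,
     [/\ p \in Z, q \in Z, p != q & lrow t0 (s^-1 p)%g = lrow t0 (s^-1 q)%g]) ->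
  \sum_(g in perm.Sym Z) (-1) ^+ odd_perm g * V (g ** x) = 0.
Proof.
move=> nz2 ZP; rewrite -[RHS](sycoef0 ab Gamma F x) -(linear0 f).
have <- : \sum_(g in perm.Sym Z) (-1) ^+ odd_perm g *: specht_act F l g (specht_gen F t0) = 0.
  apply: val_inj; rewrite linear_sum linear0 -[RHS](polytabloid_garnir nz2 ZP).
  by apply: eq_bigr => g _; rewrite linearZ /= specht_actE specht_genK.
rewrite linear_sum sycoef_sum (reindex_inj invg_inj); apply: eq_big => [g|g _].
  by rewrite groupV.
by rewrite linearZ sycoefZ odd_permV hom_sycoef_act.
Qed.

(** Every polytabloid is a translate of the one of [t0], so the coefficients of its image are
    translates of [V]. *)
Lemma hom_eq0 : (forall x, V x = 0) -> f = 0.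
Proof.
move=> V0; have f0 t : f (specht_gen F t) = 0.
  have -> : t = tab_comp (tab_perm t t0) t0.
    by apply/val_inj/ffunP => u; rewrite ffunE tab_perm_tab.
  rewrite -specht_act_gen; apply: (sycoef_inj GammaP) => d _.
  by rewrite hom_sycoef_act V0 sycoef0.
apply/lfunP => v; rewrite lfunE /= [v]specht_genE.
by rewrite linear_sum big1 // => i _; rewrite linearZ /= f0 scaler0.
Qed.

End HomCoef.

(** * The upper bound for the dimension *)

(* For two colours on Z: if the points of Z whose colour g changes all lie in M, then g
   is a permutation of M followed by a colour-preserving one. *)
Lemma Sym_color_split (T : finType) (c : T -> bool) (Z M : {set T}) (g : {perm T}) :
  g \in perm.Sym Z -> (forall p, p \in Z -> c (g p) != c p -> p \in M) ->
  exists h k, [/\ h \in perm.Sym M, k \in perm.Sym Z,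
                  forall p, c (k p) = c p & g = (h * k)%g].
Proof.
have SymZ (s : {perm T}) p : s \in perm.Sym Z -> (s p \in Z) = (p \in Z).
  by rewrite inE => Zs; rewrite perm_closed.
have [N] := ubnP #|[set p | c (g p) != c p]|.
elim: N g => // N IHN g le_N Zg bad_M.
have [/forallP cg|/forallPn[p bad_p]] := boolP [forall p, c (g p) == c p].
  by exists 1%g, g; split; rewrite ?group1 ?mul1g // => p; apply/eqP.
have Zp : p \in Z.
  apply: contraR bad_p => nZp; rewrite (out_perm _ nZp) //.
  by move: Zg; rewrite inE.
(* Another point changes colour in the opposite direction: otherwise [g] would permute the points of
   [Z] of colour [c (g p)], but it also sends [p], which has the other colour, to one of them. *)
have [q [Zq cq bad_q]] : exists q, [/\ q \in Z, c q = c (g p) & c (g q) != c q].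
  pose A := [set q in Z | c q == c (g p)].
  have [/subsetP sgA|/subsetPn[_ /imsetP[q Aq ->]]] := boolP (g @: A \subset A).
    have gA : g @: A = A.
      apply/eqP; rewrite eqEcard card_imset ?leqnn ?andbT; last exact: perm_inj.
      exact/subsetP.
    have : g p \in A by rewrite inE SymZ // Zp eqxx.
    rewrite -gA mem_imset; last exact: perm_inj.
    by rewrite inE Zp eq_sym (negPf bad_p).
  move: Aq; rewrite !inE => /andP[Zq /eqP cq]; rewrite SymZ // Zq /= => ne.
  by exists q; rewrite cq.
have npq : p != q by apply: contraNneq bad_p => e; rewrite -cq e.
have cgq : c (g q) = c p by move: bad_p bad_q; rewrite cq; do 3![case: (c _)].
have Mp := bad_M p Zp bad_p; have Mq := bad_M q Zq bad_q.
(* Swapping [p] and [q] first makes both keep their colours, so fewer points change. *)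
pose g' := (tperm p q * g)%g.
have g'E z : c (g' z) = if (z == p) || (z == q) then c z else c (g z).
  rewrite perm.permM; case: tpermP => [->|->|/eqP/negPf -> /eqP/negPf -> //].
    by rewrite eqxx cgq.
  by rewrite eqxx orbT cq.
have [|||h [k [Mh Zk ck g'hk]]] := IHN g'.
- rewrite -ltnS; apply: leq_trans le_N; rewrite ltnS; apply: proper_card.
  rewrite properE; apply/andP; split.
    apply/subsetP => z; rewrite !inE g'E; by case: ifP => //; rewrite eqxx.
  by apply/subsetPn; exists p; rewrite !inE ?g'E // eqxx /= eqxx.
- by rewrite groupM ?tperm_Sym.
- move=> z Zz; rewrite g'E; case: ifP => [_|_]; first by rewrite eqxx.
  exact: bad_M.
exists (tperm p q * h)%g, k; split=> //; first by rewrite groupM ?tperm_Sym.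
by rewrite -mulgA -g'hk mulgA tperm2 mul1g.
Qed.

Section Garnir.
Variables (n : nat) (l : intpartition n) (t : tableau l n) (p0 q0 : 'I_n).
Hypotheses (row_eq : lrow t p0 = lrow t q0) (col_lt : (lcol t p0 < lcol t q0)%N).

(** The two arms of the Garnir belt of [p0] and [q0]. *)
Definition garnir_left : {set 'I_n} :=
  [set p | (lcol t p == lcol t p0) && (lrow t p0 <= lrow t p)%N].
Definition garnir_right : {set 'I_n} :=
  [set p | (lcol t p == lcol t q0) && (lrow t p <= lrow t p0)%N].
Definition garnir_set := garnir_left :|: garnir_right.

(** Pigeonhole: the arms together meet every row of the column of [p0] and both meet the row of
    [p0], so the belt has more elements than that column. Column permutations keep the belt weakly
    to the right of that column, hence in rows that meet it. *)
Lemma garnir_setP s : s \in col_stab t -> exists p q,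
  [/\ p \in garnir_set, q \in garnir_set, p != q & lrow t (s^-1 p)%g = lrow t (s^-1 q)%g].
Proof.
rewrite -groupV => /col_stabP Cs; pose r p : 'I_(size l) := tag (tab_inv t p).
have lrE p : lrow t p = r p by [].
have [|/existsPn no] := boolP [exists p, exists q,
    [&& p \in garnir_set, q \in garnir_set, p != q & r (s^-1 p)%g == r (s^-1 q)%g]].
  by case/existsP=> p /existsP[q /and4P[Zp Zq npq /eqP e]]; exists p, q; rewrite !lrE e.
pose D := [set p | lcol t p == lcol t p0].
have col_inj (A : {set 'I_n}) j : {in A, forall p, lcol t p = j} -> #|r @: A| = #|A|.
  move=> Aj; apply: card_in_imset => p q Ap Aq e.
  by apply: (@label_inj _ _ t); rewrite ?lrE ?e ?Aj.
have rX : #|r @: garnir_left| = #|garnir_left|.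
  by apply: (col_inj _ (lcol t p0)) => p; rewrite inE => /andP[/eqP].
have rY : #|r @: garnir_right| = #|garnir_right|.
  by apply: (col_inj _ (lcol t q0)) => p; rewrite inE => /andP[/eqP].
have rZ : #|(fun p => r (s^-1 p)%g) @: garnir_set| = #|garnir_set|.
  apply: card_in_imset => p q Zp Zq e; apply/eqP/negPn/negP => npq.
  by have /existsPn/(_ q) := no p; rewrite Zp Zq npq e eqxx.
have cZ : #|garnir_set| = (#|garnir_left| + #|garnir_right|)%N.
  rewrite -cardsUI -[LHS]addn0; congr (_ + _)%N; apply/esym/eqP.
  rewrite cards_eq0; apply/eqP/setP => p; rewrite !inE.
  by apply/negP => /andP[/andP[/eqP -> _] /andP[/eqP e _]]; move: col_lt; rewrite e ltnn.
have ZD : (fun p => r (s^-1 p)%g) @: garnir_set \subset r @: D.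
  apply/subsetP => _ /imsetP[p Zp ->].
  have [q [rq cq]] : exists q, lrow t q = lrow t (s^-1 p)%g /\ lcol t q = lcol t p0.
    apply: label_left; rewrite [X in (_ <= X)%N]Cs.
    by move: Zp; rewrite !inE -/(lcol t p) => /orP[] /andP[/eqP -> _] //; exact: ltnW.
  apply/imsetP; exists q; first by rewrite inE cq.
  exact/ord_inj/esym.
have DXY : r @: D \subset (r @: garnir_left) :|: (r @: garnir_right).
  apply/subsetP => _ /imsetP[p + ->]; rewrite inE => /eqP cp; rewrite inE.
  have [le_p|lt_p] := leqP (lrow t p0) (lrow t p).
    by rewrite imset_f // inE cp eqxx.
  have [q [rq cq]] : exists q, lrow t q = lrow t p /\ lcol t q = lcol t q0.
    by apply: label_up; rewrite -row_eq ltnW.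
  have -> : r p = r q by exact/ord_inj/esym.
  by rewrite [X in _ || X]imset_f ?orbT // inE cq eqxx rq ltnW.
have XY : r p0 \in (r @: garnir_left) :&: (r @: garnir_right).
  rewrite inE imset_f ?inE ?eqxx ?leqnn //=.
  have -> : r p0 = r q0 by exact/ord_inj.
  by rewrite imset_f // inE eqxx row_eq leqnn.
have := leq_trans (subset_leq_card ZD) (subset_leq_card DXY).
rewrite rZ cZ -rX -rY -cardsUI -[X in (_ <= X)%N]addn0 leq_add2l leqNgt.
by rewrite card_gt0; case/negP; apply/set0Pn; exists (r p0).
Qed.

End Garnir.

(** * Functions determined by their values at semistandard tableaux *)

Section Vanishing.
Variables (F : fieldType) (n : nat) (l : intpartition n) (t : tableau l n).
Variable (ab : bicomposition n).
Local Notation a := (cpart ab).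
Hypothesis natf_fact : n`!%:R != 0 :> F.

Lemma natf_card_group (G : {group 'S_n}) : #|G|%:R != 0 :> F.
Proof.
have : (#|G| %| n`!)%N by rewrite -card_Sn -cardsT cardSg ?subsetT.
by case/dvdnP=> k e; move: natf_fact; rewrite e natrM mulf_eq0 negb_or => /andP[].
Qed.

(** For [n] below 2 the characteristic may be 2, hence the two distinct labels. *)
Lemma natf_two (p q : 'I_n) : p != q -> 2%:R != 0 :> F.
Proof.
move=> npq; have := natf_card_group [group of perm.Sym [set p; q]].
by rewrite perm.card_Sym cards2 npq.
Qed.

Lemma filling_perm_fun (g x : 'S_n) :
  filling ab (g ** x) =1 (fun p => filling ab x (g^-1 p)%g).
Proof. by move=> p; rewrite /filling invMg perm.permM. Qed.

Lemma wsum_filling w (g x : 'S_n) :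
  wsum w (filling ab (g ** x)) = wsum (fun p => w (g p)) (filling ab x).
Proof. by rewrite -wsum_perm; apply: eq_bigr => p _; rewrite filling_perm_fun. Qed.

Lemma tperm_col_stab p q : lcol t p = lcol t q -> tperm p q \in col_stab t.
Proof.
move=> cpq; apply/col_stabP => x; rewrite -!/(lcol t _).
by case: tpermP => [->|->|].
Qed.

Variable V : 'S_n -> F.
Hypothesis V_young : forall x xa xb, xa \in young_c ab -> xb \in young_d ab ->
  V (x ** xa ** xb) = (-1) ^+ odd_perm xb * V x.
Hypothesis V_col : forall s x, s \in col_stab t -> V (s ** x) = (-1) ^+ odd_perm s * V x.
Hypothesis V_garnir : forall (Z : {set 'I_n}) x, 2%:R != 0 :> F ->
  (forall s, s \in col_stab t -> exists p q,
     [/\ p \in Z, q \in Z, p != q & lrow t (s^-1 p)%g = lrow t (s^-1 q)%g]) ->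
  \sum_(g in perm.Sym Z) (-1) ^+ odd_perm g * V (g ** x) = 0.

(** Since [M] carries a single d colour, the conjugate of [h] by [x] lies in [young_d ab] and can be
    moved to the right of [x]. *)
Lemma V_Sym_d (M : {set 'I_n}) m x h :
  {in M, forall p, filling ab x p = m /\ (sumn a <= (x^-1)%g p)%N} ->
  h \in perm.Sym M -> V (h ** x) = (-1) ^+ odd_perm h * V x.
Proof.
move=> Mm; rewrite inE => Mh.
have -> : h ** x = x ** 1%g ** (h ^ x^-1)%g by rewrite mul1g conjgE invgK mulgA mulgKV.
rewrite V_young ?group1 //; first by rewrite odd_permJ.
have hE y : ((h ^ x^-1) y = x^-1 (h (x y)))%g.
  by rewrite -{1}[y](permK x) permJ.
apply: mem_young_d => y; rewrite hE.
  have [My|nMy] := boolP (x y \in M); last by rewrite (out_perm Mh nMy) permK.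
  have [e _] := Mm _ My; have := Mm (h (x y)).
  by rewrite (perm_closed _ Mh) => /(_ My)[]; rewrite -e /filling permK.
move=> lt_y; rewrite (out_perm Mh) ?permK //; apply/negP => /Mm[_].
by rewrite permK leqNgt lt_y.
Qed.

Lemma V_tperm_c x p q : filling ab x p = filling ab x q ->
  ((x^-1)%g p < sumn a)%N -> V (tperm p q ** x) = V x.
Proof.
move=> fpq lt_p.
have -> : tperm p q ** x = x ** (tperm p q ^ x^-1)%g ** 1%g.
  by rewrite mul1g conjgE invgK mulgA mulgKV.
rewrite V_young ?group1 //; first by rewrite odd_perm1 mul1r.
have lt_q : ((x^-1)%g q < sumn a)%N.
  by rewrite -(colour_rank_lt ab) -[colour_rank _ _]fpq colour_rank_lt.
rewrite tpermJ; apply: mem_young_c => y; case: tpermP => // ->.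
- exact: esym fpq.
- exact: fpq.
- by rewrite leqNgt lt_p.
- by rewrite leqNgt lt_q.
Qed.

(* Otherwise use the Garnir relation of p0 and q0: maxx kills the terms where some entry
   changes column, unless all such entries have the colour of p0, and each of the terms
   that remain is V x. *)
Lemma no_row_violation x p0 q0 : V x != 0 ->
  (forall y, V y != 0 -> wsum (lcol t) (filling ab y) <= wsum (lcol t) (filling ab x)) ->
  class_monotone (lcol t) (lrow t) (filling ab x) ->
  lrow t p0 = lrow t q0 -> (lcol t p0 < lcol t q0)%N ->
  (filling ab x q0 <= filling ab x p0)%N ->
  (filling ab x p0 = filling ab x q0 -> (sumn a <= (x^-1)%g p0)%N) -> False.
Proof.
move=> nzV maxx mc row_eq col_lt le_q0 d_eq.
set f := filling ab x; pose m := f p0; pose Z := garnir_set t p0 q0.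
pose M := [set p in Z | f p == m].
have npq : p0 != q0 by apply: contraTneq col_lt => ->; rewrite ltnn.
have colZ p : p \in Z -> lcol t p = if lcol t p == lcol t p0 then lcol t p0 else lcol t q0.
  rewrite !inE => /orP[] /andP[/eqP -> _]; first by rewrite eqxx.
  by case: eqP.
have fX p : p \in Z -> lcol t p = lcol t p0 -> (m <= f p)%N.
  rewrite !inE => Zp cp; apply: mc; first by rewrite cp.
  by case/orP: Zp => /andP[/eqP e] //; move: col_lt; rewrite -e cp ltnn.
have fY p : p \in Z -> lcol t p = lcol t q0 -> (f p <= f q0)%N.
  rewrite !inE => Zp cp; apply: mc; first by rewrite cp.
  rewrite -row_eq; case/orP: Zp => /andP[/eqP e] //.
  by move: col_lt; rewrite -e cp ltnn.
have SymE (s : 'S_n) p : s \in perm.Sym Z -> (s p \in Z) = (p \in Z).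
  by rewrite inE => Zs; rewrite perm_closed.
pose K := (perm.Sym Z :&: col_stab t)%G.
have VK k y : k \in K -> V (k ** y) = (-1) ^+ odd_perm k * V y.
  by case/setIP => _; exact: V_col.
(* For a d colour this is [V_Sym_d]. For a c colour [f q0] is strictly below [m], so [M] lies in the
   column of [p0] and [V_col] applies. *)
have VM h : h \in perm.Sym M -> V (h ** x) = (-1) ^+ odd_perm h * V x.
  have [le_d|lt_c] := leqP (sumn a) ((x^-1)%g p0).
    apply: (V_Sym_d (m := m)) => p; rewrite inE => /andP[_ /eqP fp]; split=> //.
    by rewrite leqNgt -(colour_rank_lt ab) [colour_rank _ _]fp colour_rank_lt -leqNgt.
  have lt_m : (f q0 < m)%N.
    rewrite ltn_neqAle le_q0 andbT; apply: contraTneq lt_c => e.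
    by rewrite -leqNgt; exact/d_eq/esym.
  rewrite inE => Mh; apply: V_col; apply/col_stabP => p; rewrite -!/(lcol t _).
  have [Mp|nMp] := boolP (p \in M); last by rewrite (out_perm Mh nMp).
  have MX q : q \in M -> lcol t q = lcol t p0.
    rewrite inE => /andP[Zq /eqP fq]; rewrite colZ //; case: eqP => // ne.
    have := fY q Zq; rewrite colZ // (introF eqP ne) => /(_ erefl).
    by rewrite fq leqNgt lt_m.
  by rewrite !MX ?(perm_closed _ Mh).
(* With the constant [m] every term of [wsum_permB] is nonnegative: the left arm has values at least
   [m] and can only move right, the right arm has values at most [m] and can only move left. By
   [maxx] all terms vanish, so a point that changes column has value [m]. *)
have supp g : g \in perm.Sym Z -> V (g ** x) != 0 -> g \in (perm.Sym M * K)%g.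
  move=> Zg nzg; have := maxx _ nzg; rewrite wsum_filling -subr_le0 (wsum_permB _ _ _ m%:Z).
  have ge0 p : 0 <= ((lcol t (g p))%:Z - (lcol t p)%:Z) * ((f p)%:Z - m%:Z).
    have [Zp|nZp] := boolP (p \in Z); last first.
      by move: Zg; rewrite inE => Zg; rewrite (out_perm Zg nZp) subrr mul0r.
    have Zgp : g p \in Z by rewrite SymE.
    have [cp|ncp] := eqVneq (lcol t p) (lcol t p0).
      apply: mulr_ge0; rewrite subr_ge0 lez_nat; last exact: fX.
      by rewrite cp (colZ (g p)) //; case: ifP => // _; exact: ltnW.
    have cp : lcol t p = lcol t q0 by rewrite colZ // (negPf ncp).
    apply: mulr_le0; rewrite subr_le0 lez_nat; last exact: leq_trans (fY _ Zp cp) le_q0.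
    by rewrite cp (colZ (g p)) //; case: ifP => // _; exact: ltnW.
  move=> le0; have /psumr_eq0P z0 : \sum_p ((lcol t (g p))%:Z - (lcol t p)%:Z) *
      ((f p)%:Z - m%:Z) = 0.
    by apply/eqP; rewrite eq_le le0 sumr_ge0.
  have [p Zp|h [k [Mh Zk ck ->]]] := @Sym_color_split _ (fun p => lcol t p == lcol t p0) Z M g Zg.
    move=> ne; have /eqP := z0 (fun p _ => ge0 p) p isT; rewrite mulf_eq0 !subr_eq0.
    case/orP => /eqP[e]; first by rewrite e eqxx in ne.
    by rewrite inE Zp e eqxx.
  apply: mem_mulg => //; rewrite inE Zk; apply/col_stabP => p; rewrite -!/(lcol t _).
  have [Zp|nZp] := boolP (p \in Z); last by move: Zk; rewrite inE => /out_perm ->.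
  by rewrite (colZ (k p)) ?SymE // ck -colZ.
have sEZ : (perm.Sym M * K \subset perm.Sym Z)%g.
  rewrite mul_subG ?subsetIl //; apply/subsetP => h; rewrite !inE => Mh.
  by apply: subset_trans Mh _; apply/subsetP => p; rewrite inE => /andP[].
have := V_garnir x (natf_two npq) (garnir_setP row_eq col_lt).
rewrite (big_setID (perm.Sym M * K)%g) /= (setIidPr sEZ) [X in _ + X]big1 ?addr0.
  rewrite (eq_bigr (fun=> V x)) => [|_ /mulsgP[h k Mh Kk ->]]; last first.
    by rewrite mulgA VK // VM // odd_permM signr_addb -mulrA !signrMK.
  rewrite sumr_const -mulr_natl => /eqP; rewrite mulf_eq0 (negPf nzV) orbF.
  (* The product set need not be a group, but its order divides the product of two group orders and
     is therefore nonzero in [F]. *)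
  have := mul_cardG (perm.Sym M) K => /(congr1 (fun k => k%:R : F)); rewrite !natrM => e /eqP z.
  move/eqP: e; rewrite z mul0r mulf_eq0 (negPf (natf_card_group [group of perm.Sym M])).
  by rewrite (negPf (natf_card_group K)).
move=> g /setDP[Zg nEg]; have [->|nz] := eqVneq (V (g ** x)) 0; first by rewrite mulr0.
by rewrite supp in nEg.
Qed.

Lemma V_eq0 : (forall d, sstd_filling t ab d -> V d = 0) -> forall x, V x = 0.
Proof.
move=> V0 x1; apply/eqP; apply: contraT => nz1.
pose Phi y := wsum (lcol t) (filling ab y); pose Psi y := wsum (lrow t) (filling ab y).
case: (@arg_maxP _ _ _ x1 (fun y => V y != 0) Phi nz1) => x0 nz0 max0.
have Q0 : (V x0 != 0) && (Phi x0 == Phi x0) by rewrite nz0 eqxx.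
case: (@arg_maxP _ _ _ x0 (fun y => (V y != 0) && (Phi y == Phi x0)) Psi Q0).
move=> x /andP[nzx /eqP Phix] maxx.
have {}max0 y : V y != 0 -> Phi y <= Phi x by rewrite Phix; exact: max0.
have {}maxx y : V y != 0 -> Phi y = Phi x -> Psi y <= Psi x.
  by move=> nzy e; apply: maxx; rewrite nzy e Phix eqxx.
have VN p q : lcol t p = lcol t q -> p != q -> V (tperm p q ** x) = - V x.
  by move=> cpq npq; rewrite V_col ?tperm_col_stab // odd_tperm npq mulN1r.
(* Swapping an inversion within a column leaves [Phi] unchanged and increases [Psi]. *)
have mc : class_monotone (lcol t) (lrow t) (filling ab x).
  move=> p q cpq le_r; rewrite leqNgt; apply/negP => lt_f.
  have npq : p != q by apply: contraTneq lt_f => ->; rewrite ltnn.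
  have lt_r : (lrow t p < lrow t q)%N.
    rewrite ltn_neqAle le_r andbT; apply: contraNneq npq => e.
    exact/eqP/(label_inj e cpq).
  have : Psi (tperm p q ** x) <= Psi x.
    apply: maxx; first by rewrite VN // oppr_eq0.
    rewrite /Phi wsum_filling; apply: eq_bigr => z _; congr (_%:Z * _).
    by case: tpermP => // ->.
  rewrite -subr_le0 /Psi wsum_filling wsum_tpermB leNgt => /negP[].
  by apply: mulr_gt0; rewrite subr_gt0.
have no := no_row_violation nzx max0 mc.
suff ss : sstd_filling t ab x by rewrite V0 ?eqxx in nzx.
split=> //.
- move=> p q rpq le_c; rewrite leqNgt; apply/negP => lt_f.
  have lt_c : (lcol t p < lcol t q)%N.
    rewrite ltn_neqAle le_c andbT; apply: contraTneq lt_f => e.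
    by rewrite (label_inj rpq e) ltnn.
  by apply: (no p q rpq lt_c (ltnW lt_f)) => e; rewrite e ltnn in lt_f.
- move=> p q npq rpq fpq; rewrite ltnNge; apply/negP => le_d.
  have le_d' : (sumn a <= (x^-1)%g q)%N.
    by rewrite leqNgt -(colour_rank_lt ab) -[colour_rank _ _]fpq colour_rank_lt -leqNgt.
  case: (ltngtP (lcol t p) (lcol t q)) => [lt_c|lt_c|e].
  - by apply: (no p q) => //; rewrite -fpq.
  - by apply: (no q p) => //; rewrite -fpq.
  by rewrite (label_inj rpq e) eqxx in npq.
(* Swapping two equal c colours in a column gives both [V x] and [- V x]. *)
move=> p q npq cpq fpq; rewrite leqNgt; apply/negP => lt_p.
have := VN p q cpq npq; rewrite V_tperm_c // => /eqP; rewrite -addr_eq0 -mulr2n.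
by rewrite -mulr_natl mulf_eq0 (negPf (natf_two npq)) (negPf nzx).
Qed.

End Vanishing.

(** * Linear independence *)

Section Independence.
Variables (n : nat) (l : intpartition n) (ab : bicomposition n) (t0 : tableau l n).
Local Notation a := (cpart ab).
Local Notation row_weight d := (wsum (lrow t0) (filling ab d)).

Lemma eps_young d x xa xb : d \in good ab t0 -> xa \in young_c ab -> xb \in young_d ab ->
  eps ab t0 d (x ** xa ** xb) = sgnz xb * eps ab t0 d x.
Proof.
move=> Gd Sa Sb; have [/dcosetP[r [ya [yb [Rr Ta Tb ->]]]]|Nx] := boolP (x \in dcoset ab t0 d).
  have -> : r ** d ** ya ** yb ** xa ** xb = r ** d ** (ya ** xa) ** (yb ** xb).
    by rewrite -!mulgA (mulgA xa yb) (young_cdC Sa Tb) -!mulgA.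
  by rewrite !epsE ?groupM // /sgnz odd_permM signr_addb.
rewrite !eps_out ?mulr0 //; apply: contra Nx => /dcosetP[r [ya [yb [Rr Ta Tb e]]]].
apply/dcosetP; exists r, (xa^-1 * ya)%g, (xb^-1 * yb)%g; split; rewrite ?groupM ?groupV //.
have ab_inv : (xa^-1 * xb^-1 = xb^-1 * xa^-1)%g by rewrite -!invMg (young_cdC Sa Sb).
apply: (mulgI xa); apply: (mulgI xb); rewrite e !mulgA; congr (_ * _ * _)%g.
have -> : (xb * xa * xb^-1 = xa)%g by rewrite -(young_cdC Sa Sb) mulgK.
by rewrite -!mulgA (mulgA yb) -(young_cdC (groupVr Sa) Tb) !mulgA mulgV mul1g.
Qed.

Lemma acoef_young d d' xa xb : d' \in good ab t0 -> xa \in young_c ab ->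
  xb \in young_d ab -> acoef ab t0 (d ** xa ** xb) d' = sgnz xb * acoef ab t0 d d'.
Proof.
move=> Gd' Sa Sb; rewrite !acoefE mulr_sumr; apply: eq_bigr => s _.
by rewrite mulrCA -(eps_young _ Gd' Sa Sb) !mulgA.
Qed.

(** Neither [r] nor [h] affects the row weight, so that of [d'] is the one of [s ** d], a
    rearrangement within columns of the sorted filling of [d]. *)
Lemma row_weight_leif d d' s r h : s \in col_stab t0 -> r \in row_stab t0 ->
  h \in young_cd ab -> s ** d = r ** d' ** h ->
  class_monotone (lcol t0) (lrow t0) (filling ab d) ->
  row_weight d' <= row_weight d ?= iff [forall p, filling ab (s ** d) p == filling ab d p].
Proof.
move=> /col_stabP Cs /row_stabP Rr Sh e mc.
have -> : row_weight d' = row_weight (s ** d).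
  rewrite e; transitivity (row_weight (r ** d')).
    by rewrite wsum_filling; apply: eq_bigr => p _; rewrite [X in _ = X%:Z * _]Rr.
  by apply: eq_bigr => p _; rewrite (filling_young _ Sh).
have inj p q : lcol t0 p = lcol t0 q -> lrow t0 p = lrow t0 q -> p = q.
  by move=> c r0; apply: label_inj r0 c.
have := class_monotone_wsum inj Cs mc; congr (Order.leif _ _ _).
  by apply: eq_bigr => p _; rewrite filling_perm_fun.
by apply: eq_forallb => p; rewrite filling_perm_fun.
Qed.

Lemma acoef_neq0 d d' : sstd_filling t0 ab d -> sstd_filling t0 ab d' ->
  acoef ab t0 d d' != 0 -> row_weight d' < row_weight d \/ filling ab d =1 filling ab d'.
Proof.
move=> [mr mc _ _] [mr' _ _ _] nz.
have [s Cs nzs] : exists2 s, s \in col_stab t0 & s ** d \in dcoset ab t0 d'.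
  apply/exists_inP; apply: contraNT nz => /exists_inPn no; rewrite acoefE big1 // => s Cs.
  by rewrite eps_out ?mulr0 // no.
have /dcosetP[r [xa [xb [Rr Sa Sb e]]]] := nzs.
have Sh : xa ** xb \in young_cd ab by apply/imset2P; exists xa xb.
have e' : s ** d = r ** d' ** (xa ** xb) by rewrite e !mulgA.
have [le_w eq_w] := row_weight_leif Cs Rr Sh e' mc.
have [eqw|ltw] := eqVneq (row_weight d') (row_weight d); last first.
  by left; rewrite lt_neqAle ltw.
(* Equality means that [s] fixes the filling of [d]. The fillings of [d] and [d'] are then
   rearrangements of each other within rows, and both have sorted rows. *)
right; move: eq_w; rewrite eqw eqxx => /esym/forallP fsd.
have rE p : filling ab d (r p) = filling ab d' p.
  by rewrite -(eqP (fsd (r p))) e' (filling_young _ Sh) filling_perm.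
have := class_monotone_uniq (row_stabP _ _ Rr) rE mr' mr.
by move=> H p; rewrite H.
Qed.

(** If [s ** d] lies in the double coset of [d], the case of equality in [row_weight_leif] shows
    that [s] preserves the filling. As columns repeat only d colours, the conjugate of [s] by [d] is
    then in [young_d ab], so the two signs cancel and each term is 1. *)
Lemma acoef_diag d : sstd_filling t0 ab d ->
  acoef ab t0 d d = #|(col_stab t0 :&: young_cd ab :^ d)%g|%:R.
Proof.
move=> ssd; have Gd := sstd_filling_good ssd; have [_ mc _ dc] := ssd.
rewrite acoefE -sum1_card natr_sum big_mkcond [RHS]big_mkcond /=.
apply: eq_bigr => s _; rewrite in_setI; case: (boolP (s \in col_stab t0)) => //= Cs.
rewrite mem_conjg; case: ifPn => [Sh|nSh].
  set h := (s ^ d^-1)%g in Sh; have /young_cdP hC := Sh.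
  have hE x : h x = (d^-1 (s (d x)))%g by rewrite -{1}[x](permK d) permJ.
  have Dh : h \in young_d ab.
    apply: mem_young_d => // x lt_x; apply/eqP/negPn/negP => ne.
    have : (sumn a <= (d^-1)%g (s (d x)))%N.
      apply: (dc _ (d x)).
      - by apply: contra ne => /eqP e; rewrite hE e permK.
      - exact: (col_stabP _ _ Cs).
      by rewrite /filling -hE hC permK.
    by rewrite -hE leqNgt -(colour_rank_lt ab) hC colour_rank_lt lt_x.
  have -> : s ** d = 1%g ** d ** 1%g ** h.
    by rewrite mulg1 mul1g /h conjgE invgK -!mulgA mulVg mulg1.
  by rewrite epsE ?group1 // /sgnz odd_permJ -signr_addb addbb.
rewrite eps_out ?mulr0 //; apply: contra nSh => /dcosetP[r [xa [xb [Rr Sa Sb e]]]].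
have Sh : xa ** xb \in young_cd ab by apply/imset2P; exists xa xb.
have e' : s ** d = r ** d ** (xa ** xb) by rewrite e !mulgA.
have [_] := row_weight_leif Cs Rr Sh e' mc; rewrite eqxx => /esym/forallP fsd.
have /filling_eqP[h Sh' eh] : [forall p, filling ab d p == filling ab (s ** d) p].
  by apply/forallP => p; rewrite eq_sym fsd.
by rewrite conjgE invgK mulgA eh mulgK.
Qed.

Variables (F : fieldType) (Gamma : {set 'S_n}).
Hypothesis GammaP : left_transversal (young_cd ab) Gamma.

(** On [Gamma] this is the definition; elsewhere both sides change by the same sign under
    [young_cd ab]. *)
Lemma sycoef_theta_val d' t x : d' \in good ab t0 ->
  sycoef ab (theta_val F ab t0 Gamma d' t) x =
  (acoef ab t0 ((tab_perm t t0)^-1%g ** x) d')%:~R.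
Proof.
move=> Gd'; have [d [xa [xb [Gd Sa Sb ->]]]] := transversal_split GammaP x.
rewrite sycoef_young //; set rho := tab_perm t t0.
have -> : rho^-1%g ** (d ** xa ** xb) = rho^-1%g ** d ** xa ** xb by rewrite !mulgA.
rewrite acoef_young // rmorphM rmorph_sign; congr (_ * _).
rewrite sycoef_sum (bigD1 d) //= sycoefZ.
rewrite (sycoef_basis GammaP _ Gd) tens_basis // ffunE eqxx mulr1 big1 ?addr0 //.
move=> e /andP[Ge ne]; rewrite sycoefZ (sycoef_basis GammaP _ Gd) tens_basis // ffunE.
by rewrite /= eq_sym (negPf ne) mulr0.
Qed.

Lemma theta_HomS d' : d' \in good ab t0 ->
  theta F ab t0 Gamma d' \in HomS (specht_act F l) (syM_act F ab Gamma).
Proof.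
move=> Gd'; apply/HomSP => s u; rewrite [u]specht_genE !linear_sum.
apply: eq_bigr => i _; rewrite !linearZ; congr (_ *: _).
rewrite /= specht_act_gen !theta_genE //; apply: (sycoef_inj GammaP) => d _.
rewrite sycoef_act // !sycoef_theta_val // tab_perm_compl.
by rewrite invMg !mulgA.
Qed.

Hypothesis natf_fact : n`!%:R != 0 :> F.

Lemma Gamma_sstd_filling d : d \in Gamma_sstd ab t0 Gamma ->
  d \in Gamma /\ sstd_filling t0 ab d.
Proof. by rewrite inE => /andP[Gd /sstdP]. Qed.

Lemma theta_free :
  free [seq theta F ab t0 Gamma d | d <- enum (Gamma_sstd ab t0 Gamma)].
Proof.
set A := Gamma_sstd ab t0 Gamma; pose X := [tuple of map (theta F ab t0 Gamma) (enum_tuple A)].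
suff : free X by [].
apply/freeP => k sum0; pose e (i : 'I_#|A|) := enum_val i.
have eA i : e i \in Gamma /\ sstd_filling t0 ab (e i).
  exact/Gamma_sstd_filling/enum_valP.
have {}sum0 x : \sum_i k i * (acoef ab t0 x (e i))%:~R = 0.
  transitivity (sycoef ab ((\sum_i k i *: X`_i) (specht_gen F t0)) x); last first.
    by rewrite sum0 zero_lfunE sycoef0.
  rewrite sum_lfunE sycoef_sum.
  apply: eq_bigr => i _; rewrite scale_lfunE sycoefZ; congr (_ * _).
  rewrite -tnth_nth tnth_map (tnth_nth 1%g) -enum_val_nth theta_genE; last first.
    by apply: sstd_filling_good; case: (eA i).
  rewrite sycoef_theta_val ?tab_perm_id ?invg1 ?mulg1 //.
  by apply: sstd_filling_good; case: (eA i).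
move=> i0; apply/eqP; apply: contraT => nz0.
(* With minimal row weight, evaluation at [e i] leaves only the diagonal term, by [acoef_neq0] and
   [transversal_inj]. *)
case: (@arg_minP _ _ _ i0 (fun i => k i != 0) (fun i => row_weight (e i)) nz0).
move=> i nzi min_i; have [Gi ssi] := eA i.
have := sum0 (e i); rewrite (bigD1 i) //= big1 => [|j ne].
  rewrite addr0 acoef_diag // => /eqP; rewrite mulf_eq0 (negPf nzi) rmorph_nat /=.
  by rewrite (negPf (natf_card_group natf_fact [group of (col_stab t0 :&: young_cd ab :^ e i)%g])).
have [Gj ssj] := eA j; have [->|nzj] := eqVneq (k j) 0; first by rewrite mul0r.
have [->|nza] := eqVneq (acoef ab t0 (e i) (e j)) 0; first by rewrite mulr0.
have [lt_w|eqf] := acoef_neq0 ssi ssj nza.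
  by have := min_i j nzj; rewrite leNgt lt_w.
have := transversal_inj GammaP Gi Gj eqf => /enum_val_inj eij.
by rewrite eij eqxx in ne.
Qed.

(** * Dimension bound and the basis property *)

Lemma dim_HomS_le :
  (\dim (HomS (specht_act F l) (syM_act F ab Gamma)) <= #|Gamma_sstd ab t0 Gamma|)%N.
Proof.
set A := Gamma_sstd ab t0 Gamma; set H := HomS _ _.
pose E (f : 'Hom(spechtM F l, syM F Gamma)) : 'rV[F]_#|A| :=
  \row_i sycoef ab (f (specht_gen F t0)) (enum_val i).
have E_lin : linear E.
  move=> k f g; apply/rowP => i; rewrite !mxE.
  by rewrite add_lfunE scale_lfunE sycoefD sycoefZ.
pose EL : {linear _ -> 'rV[F]_#|A|} := HB.pack E (GRing.isLinear.Build F _ _ _ _ E_lin).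
have ker0 : (H :&: lker (linfun EL) = 0)%VS.
  apply/eqP; rewrite -subv0; apply/subvP => f; rewrite memv_cap memv_ker lfunE memv0.
  case/andP=> Hf /eqP/rowP Ef; apply/eqP; apply: (hom_eq0 (t0 := t0) GammaP Hf).
  apply: (V_eq0 natf_fact (t := t0) (ab := ab)).
  - by move=> x xa xb Sa Sb; exact: sycoef_young.
  - by move=> s x Cs; exact: hom_sycoef_col.
  - by move=> Z x nz2 ZP; exact: hom_sycoef_garnir.
  (* [V_eq0] needs all semistandard [x], not only those in [Gamma]; the representative of the coset
     of [x] has the same filling, so it is semistandard too. *)
  move=> x ssx; have [d [xa [xb [Gd Sa Sb xE]]]] := transversal_split GammaP x.
  rewrite xE sycoef_young //.
  have Ad : d \in A.
    rewrite inE Gd; apply/sstdP; case: ssx => mr mc dr dc.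
    have fE p : filling ab x p = filling ab d p.
      by rewrite xE mulgA filling_young //; apply/imset2P; exists xa xb.
    have aE p : ((x^-1)%g p < sumn a)%N = ((d^-1)%g p < sumn a)%N.
      by rewrite -!(colour_rank_lt ab) -!/(filling ab _ p) fE.
    split=> p q; rewrite -?fE -?aE; [exact: mr|exact: mc|exact: dr|].
    by rewrite leqNgt -aE -leqNgt; exact: dc.
  by have := Ef (enum_rank_in Ad d); rewrite !mxE enum_rankK_in // => ->; rewrite mulr0.
rewrite -(limg_dim_eq ker0) (leq_trans (dimvS (subvf _))) // dimvf /dim /=.
by rewrite mul1n.
Qed.

End Independence.

Theorem theorem4p11 (F : fieldType) (n : nat) (n_gt0 : (0 < n)%N)
    (l : intpartition n) (ab : bicomposition n)
    (t0 : tableau l n) (Gamma : {set 'S_n})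
    (GammaP : left_transversal (young_cd ab) Gamma)
    (FSn_semisimple : mxsemisimple (regular_repr F [set: 'S_n]) 1%:M) :
  basis_of (HomS (specht_act F l) (syM_act F ab Gamma))
    [seq theta F ab t0 Gamma d | d <- enum (Gamma_sstd ab t0 Gamma)].
Proof.
have natf_fact : n`!%:R != 0 :> F.
  by have := semisimple_natf_card FSn_semisimple; rewrite cardsT card_Sn.
rewrite basisEfree theta_free //= size_map -cardE dim_HomS_le // andbT.
apply/span_subvP => _ /mapP[d + ->]; rewrite mem_enum => /Gamma_sstd_filling[_ ssd].
exact/theta_HomS/sstd_filling_good.
Qed.
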